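(* Let $\mathcal A=\{A_1,\dots,A_m\}$ be a positively irreducible finite family of (entrywise) non-negative $d\times d$ matrices that has a unique dominant product with a unique and simple leading eigenvalue. Then $\mathcal A$ possesses a unique monotone invariant body and a unique monotone Barabanov norm (each up to multiplication by a positive constant). The invariant body is a monotone polytope. The monotone Barabanov norm is given by the formula $$f(x)=\max_{v^*}\,(v^*,x),\qquad x\in\mathbb R^d_+,$$ where the maximum is taken over all vertices $v^*$ of the monotone invariant polytope $G^*$ of the transpose (dual) family $\mathcal A^*=\{A_1^T,\dots,A_m^T\}$.
   Context: Inequalities between vectors are entrywise; $\mathbb R^d_+=\{x\in\mathbb R^d:x\ge0\}$; $(\cdot,\cdot)$ is the standard inner product. $\mathcal A$ is positively irreducible if the matrices from $\mathcal A$ do not share a nontrivial invariant coordinate subspace, i.e. a subspace $\{x\in\mathbb R^d:x_i=0,\ i\notin S\}$ with $\emptyset\ne S\subsetneq\{1,\dots,d\}$. $\mathcal A^n$ is the set of all products of $n$ matrices from $\mathcal A$ (repetitions permitted), $\mathcal A^{\mathbb N}=\bigcup_{n\ge1}\mathcal A^n$; products are regarded as words, $|\Pi|$ is the length of $\Pi$. $\rho(S)$ is the spectral radius of a matrix; $\rho(\mathcal A)=\lim_{n\to\infty}\max_{\Pi\in\mathcal A^n}\|\Pi\|^{1/n}$ is the joint spectral radius; $\nu(\Pi)=\rho(\Pi)^{1/|\Pi|}$. Norms here are defined on $\mathbb R^d_+$ (positively homogeneous, subadditive, positive off zero); a norm $f$ is monotone if $f(x)\ge f(y)$ whenever $x\ge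 y\ge0$. A monotone convex body is a compact convex set $G\subset\mathbb R^d_+$ with nonempty interior such that $x\in G$ and $0\le y\le x$ imply $y\in G$. For $K\subset\mathbb R^d_+$ the monotone convex hull is $\mathrm{co}_-K=\{y\in\mathbb R^d_+:\exists\,x\in\mathrm{co}\,K,\ x\ge y\}$. The monotone convex hull of a finite set is a monotone polytope; its vertices are the points of the minimal finite set of which it is the monotone convex hull. A monotone norm $f$ is Barabanov for $\mathcal A$ if $\rho(\mathcal A)f(x)=\max_{A_j\in\mathcal A}f(A_jx)$ for all $x\in\mathbb R^d_+$. A monotone convex body $G$ is a monotone invariant body of $\mathcal A$ if $\rho(\mathcal A)\,G=\mathrm{co}_-\bigl(\bigcup_{A_j\in\mathcal A}A_jG\bigr)$. A product is primitive if it is not a power of a shorter product. A set $\mathcal P\subset\mathcal A^{\mathbb N}$ is a set of dominant products if: (1) all its elements are primitive and none is a cyclic permutation of another; (2) there is $q$ with $\nu(\Pi)=q$ for all $\Pi\in\mathcal P$; (3) there is $\varepsilon>0$ such that every $S\in\mathcal A^{\mathbb N}$ satisfies $\nu(S)\le(1-\varepsilon)^{1/|S|}q$ unless $S$ is a power of some product from $\mathcal P$ or of one of its cyclic permutations. $\mathcal A$ has a unique dominant product $\Pi$ if $\mathcal P=\{\Pi\}$ is a set of dominant products. A leading eigenvalue is an eigenvalue of largest modulus; it is unique and simple if it is not multiple and all other eigenvalues (except for its complex conjugate if it is non-real) are strictly smaller in modulus. *)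

(* Defs.v *)
From mathcomp Require Import all_boot all_order all_algebra.
From mathcomp Require Import all_classical all_reals all_analysis.
From mathcomp.real_closed Require Import complex.
Import Order.TTheory GRing.Theory Num.Theory.
Import numFieldNormedType.Exports.

Set Implicit Arguments.
Unset Strict Implicit.
Unset Printing Implicit Defensive.

Local Open Scope classical_set_scope.
Local Open Scope ring_scope.

Definition is_max (R : realType) (E : set R) (y : R) : Prop :=
  E y /\ ubound E y.

Section Cone.
Context {R : realType} {d : nat}.
Implicit Types (x y v : 'cV[R]_d) (G K V : set 'cV[R]_d).

Definition mx_nonneg m n (M : 'M[R]_(m, n)) : Prop := forall i j, 0 <= M i j.

Definition vle x y : Prop := forall i, x i 0 <= y i 0.

Definition cone : set 'cV[R]_d := [set x | vle 0 x].

Definition dotp x y : R := \sum_(i < d) x i 0 * y i 0.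

Definition scale_set (c : R) G : set 'cV[R]_d := [set c *: x | x in G].

Definition conv_hull K : set 'cV[R]_d :=
  smallest (@convex_set R 'cV[R]_d) K.

Definition mono_hull K : set 'cV[R]_d :=
  [set y | cone y /\ exists2 x, conv_hull K x & vle y x].

Definition mono_body G : Prop :=
  [/\ compact G,
      @convex_set R 'cV[R]_d G,
      G° !=set0,
      G `<=` cone
    & forall x y, G x -> vle 0 y -> vle y x -> G y].

Definition mono_polytope G : Prop :=
  exists K, [/\ finite_set K, K `<=` cone & G = mono_hull K].

(* "The minimal finite set" is read as the least one for inclusion. *)
Definition is_vertex_set G V : Prop :=
  [/\ finite_set V, V `<=` cone, G = mono_hull V
    & forall W, finite_set W -> W `<=` cone -> G = mono_hull W -> V `<=` W].

(* Only the values of f on the cone matter. *)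
Definition cone_norm (f : 'cV[R]_d -> R) : Prop :=
  [/\ forall (c : R) x, 0 <= c -> cone x -> f (c *: x) = c * f x,
      forall x y, cone x -> cone y -> f (x + y) <= f x + f y
    & forall x, cone x -> x != 0 -> 0 < f x].

Definition mono_norm (f : 'cV[R]_d -> R) : Prop :=
  cone_norm f /\ forall x y, vle 0 y -> vle y x -> f y <= f x.

End Cone.

Section Spectrum.
Context {R : realType} {d : nat}.
Implicit Types M : 'M[R]_d.

Definition complexify M : 'M[R[i]]_d := map_mx (real_complex R) M.

Definition spectral_radius M : R :=
  sup [set complex.Re `|z| | z in [set z | eigenvalue (complexify M) z]].

(* "Not multiple" refers to the algebraic multiplicity. *)
Definition unique_simple_leading_eigenvalue M (lam : R[i]) : Prop :=
  [/\ eigenvalue (complexify M) lam,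
      forall mu, eigenvalue (complexify M) mu -> `|mu| <= `|lam|,
      mup lam (char_poly (complexify M)) = 1%N
    & forall mu, eigenvalue (complexify M) mu ->
        mu != lam -> mu != conjc lam -> `|mu| < `|lam|].

End Spectrum.

Section Words.
Context {m : nat}.
Implicit Types u v w : seq 'I_m.

Definition word_pow w k : seq 'I_m := flatten (nseq k w).

Definition primitive w : Prop :=
  ~ exists u k, (size u < size w)%N /\ w = word_pow u k.

Definition cyclic_perm v w : Prop := exists i, w = rot i v.

End Words.

Section Family.
Context {R : realType} {d m : nat}.
Implicit Types (A : 'I_m -> 'M[R]_d) (w : seq 'I_m).

Definition family_nonneg A : Prop := forall j, mx_nonneg (A j).

Definition coord_subspace (S : {set 'I_d}) : set 'cV[R]_d :=
  [set x | forall i, i \notin S -> x i 0 = 0].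

Definition positively_irreducible A : Prop :=
  ~ exists S : {set 'I_d},
      [/\ S != finset.set0, S \proper finset.setTfor 'I_d
        & forall j, [set A j *m x | x in coord_subspace S]
                      `<=` coord_subspace S].

Definition dual_family A : 'I_m -> 'M[R]_d := fun j => (A j)^T.

Definition word_prod A w : 'M[R]_d := \prod_(j <- w) A j.

(* The entrywise maximum norm is used; the limit does not depend on the
   choice of the norm. *)
Definition jsr A : R :=
  lim ((fun n => \big[Num.max/0]_(w : n.-tuple 'I_m)
                   (`|word_prod A w| `^ n%:R^-1)) @ \oo).

Definition nu A w : R := spectral_radius (word_prod A w) `^ (size w)%:R^-1.

(* Products are nonempty words over the index set 'I_m.  The bound eps < 1 is
   implicit in the expression (1 - eps)^(1/|S|); without it `^ would return 1
   on a negative base. *)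
Definition dominant_products A (P : set (seq 'I_m)) : Prop :=
  [/\ forall w, P w -> w <> [::] /\ primitive w,
      forall v w, P v -> P w -> v <> w -> ~ cyclic_perm v w
    & exists q : R,
        (forall w, P w -> nu A w = q) /\
        exists eps : R, [/\ 0 < eps, eps < 1 &
          forall s, s <> [::] ->
            ~ (exists w u k, [/\ P w, cyclic_perm w u & s = word_pow u k]) ->
            nu A s <= (1 - eps) `^ (size s)%:R^-1 * q]].

Definition unique_dominant_product A w : Prop := dominant_products A [set w].

Definition barabanov A (f : 'cV[R]_d -> R) : Prop :=
  mono_norm f /\
  forall x, cone x -> is_max [set f (A j *m x) | j in setT] (jsr A * f x).

Definition invariant_body A (G : set 'cV[R]_d) : Prop :=
  mono_body G /\
  scale_set (jsr A) G = mono_hull (\bigcup_j [set A j *m x | x in G]).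

End Family.

(* Main.v *)
(** Divide the family by [q = nu(Pi)], [Pi] being the dominant product with
    word [w].  Irreducibility bounds each entry of a product by the trace of a
    slightly longer one, hence by the spectral radii: the semigroup generated
    by the normalized family is bounded, and its joint spectral radius is 1.
    By Perron's theorem the leading eigenvalue of [Pi] is then 1, and since it
    is simple and unique, [Pi^k] tends to a rank one projection [v r].

    A long product that is not small has two nearby prefixes among many, so it
    contains a factor [S] with [p S] close to [p] for some large row [p]; as
    [det (1 - S)] is bounded away from 0 unless [S] is a power of a rotation
    of [Pi], the product has the form [A_a Pi^K A_b] with [K] large.  It is
    therefore close to [(A_a v) (r A_b)].  Moreover [r A_b v <= 1], with a
    uniform gap unless [b] is a power of [w].

    Consequently, the point [A_a Pi^K A_b v] lies in the monotone hull of the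
    shorter orbit point [A_a v] and of a small box, so finitely many points of
    the orbit of [v] span an invariant polytope [Q].  For any invariant body
    [G], the largest multiple [c v] in [G] gives [c Q <= G], while points of
    [G], being combinations of images of [G] under long products, lie in
    [(c + eta) Q] for all [eta > 0]; so [G = c Q].  In the same way, two
    Barabanov norms [f, g] satisfy [f(x) g(v) = g(x) f(v)].  Existence of the
    norm comes from duality: the support function of the invariant body of the
    transposed family is a Barabanov norm. *)

Require Import Defs.
From mathcomp Require Import all_boot all_order all_algebra.
From mathcomp Require Import all_classical all_reals all_analysis.
From mathcomp.real_closed Require Import complex.
From mathcomp Require Import spectral perm ring lra.
Import Order.TTheory GRing.Theory Num.Theory numFieldNormedType.Exports.

Set Implicit Arguments.
Unset Strict Implicit.
Unset Printing Implicit Defensive.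

Local Open Scope classical_set_scope.
Local Open Scope ring_scope.

(** * Spectra and Perron's theorem *)

Lemma mulmx_trig (R : pzRingType) n (S T : 'M[R]_n) :
  is_trig_mx S -> is_trig_mx T ->
  is_trig_mx (S *m T) /\ forall i, (S *m T) i i = S i i * T i i.
Proof.
move=> /is_trig_mxP hS /is_trig_mxP hT; split.
  apply/is_trig_mxP => i j ij; rewrite mxE big1 // => k _.
  case: (ltnP i k) => [ik|ki]; first by rewrite hS ?mul0r.
  by rewrite hT ?mulr0 // (leq_ltn_trans ki).
move=> i; rewrite mxE (bigD1 i) //= big1 ?addr0 // => k ki.
have [ik|ki'|/ord_inj e] := ltngtP i k; first by rewrite hS ?mul0r.
  by rewrite hT ?mulr0.
by rewrite e eqxx in ki.
Qed.

Lemma exprmx_trig (R : pzRingType) n (T : 'M[R]_n) k :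
  is_trig_mx T ->
  is_trig_mx (T ^+ k) /\ forall i, (T ^+ k) i i = T i i ^+ k.
Proof.
move=> hT; elim: k => [|k [IH1 IH2]].
  by rewrite !expr0; split=> [|i]; rewrite ?scalar_mx_is_trig // mxE eqxx expr0.
have [h1 h2] := mulmx_trig hT IH1.
by rewrite exprS; split=> // i; rewrite h2 IH2 exprS.
Qed.

Lemma exprmx_conj (R : comUnitRingType) n (P T : 'M[R]_n) k :
  P \in unitmx -> (invmx P *m T *m P) ^+ k = invmx P *m (T ^+ k) *m P.
Proof.
move=> uP; elim: k => [|k IH]; first by rewrite !expr0 mulmx1 mulVmx.
by rewrite !exprS IH -!mulmxE !mulmxA mulmxK.
Qed.

Lemma char_poly_conj (R : comUnitRingType) n (P T : 'M[R]_n) :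
  P \in unitmx -> char_poly (invmx P *m T *m P) = char_poly T.
Proof.
move=> uP; rewrite /char_poly.
suff -> : char_poly_mx (invmx P *m T *m P) =
   map_mx polyC (invmx P) *m char_poly_mx T *m map_mx polyC P.
  rewrite !det_mulmx mulrC mulrA -det_mulmx -map_mxM mulmxV //.
  by rewrite map_mx1 det1 mul1r.
rewrite /char_poly_mx mulmxBr mulmxBl !map_mxM; congr (_ - _).
by rewrite mul_mx_scalar -scalemxAl -map_mxM mulVmx // map_mx1 scalemx1.
Qed.

(** Schur triangularization: the diagonal of the triangular form yields both the characteristic
    polynomial and the traces of powers. The factor [c] is built in so that one list serves the
    matrix and all its rescalings. *)
Lemma spectrum_exists (C : numClosedFieldType) n (M : 'M[C]_n) :
  exists2 rs : seq C, size rs = n & forall c,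
    char_poly (c *: M) = \prod_(z <- rs) ('X - (c * z)%:P) /\
    forall k, \tr ((c *: M) ^+ k) = \sum_(z <- rs) (c * z) ^+ k.
Proof.
case: (posnP n) => [n0|n_gt0].
  exists [::] => // c; rewrite big_nil; subst n; split; first exact: det_mx00.
  by move=> k; rewrite big_nil /mxtrace big_ord0.
have [P uniP] := Schur M n_gt0.
have uP := unitarymx_unit uniP.
have sP : stablemx P M by rewrite stablemx_unit.
rewrite /similar_to /= => trigT; set T := conjmx P M in trigT.
have EM : M = invmx P *m T *m P.
  by rewrite /T conjumx // !mulmxA mulVmx // mul1mx mulmxKV.
exists [seq T i i | i <- enum 'I_n] => [|c]; first by rewrite size_map size_enum_ord.
have Ec : c *: M = invmx P *m (c *: T) *m P.
  by rewrite EM -scalemxAr -scalemxAl.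
have trigc : is_trig_mx (c *: T).
  by apply/is_trig_mxP => i j ij; rewrite mxE (is_trig_mxP trigT) ?mulr0.
split=> [|k].
  rewrite Ec char_poly_conj // char_poly_trig // big_map big_enum /=.
  by apply: eq_bigr => i _; rewrite mxE.
rewrite Ec exprmx_conj // mxtrace_mulC mulmxA mulmxV // mul1mx /mxtrace.
rewrite big_map big_enum /=; apply: eq_bigr => i _.
by rewrite (proj2 (exprmx_trig k trigc)) mxE.
Qed.

Lemma sum_geom_bound (C : numFieldType) (z : C) :
  `|z| <= 1 -> z != 1 ->
  forall n, `|\sum_(k < n) z ^+ k| <= 2 / `|z - 1|.
Proof.
move=> z1 zn1 n; have h : 0 < `|z - 1| by rewrite normr_gt0 subr_eq0.
rewrite ler_pdivlMr // mulrC -normrM -subrX1.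
apply: le_trans (ler_normB _ _) _.
by rewrite normr1 normrX -[2]/(1 + 1) lerD2r exprn_ile1.
Qed.

(** Over the closed unit disc the geometric sums of [z] stay bounded, except for [z = 1], where they
    equal [n]. So summed power sums count the multiplicity of 1 up to a bounded error. *)
Lemma power_sums_bound (C : numFieldType) (rs : seq C) :
  (forall z, z \in rs -> `|z| <= 1) ->
  exists B : C, forall n,
    `|\sum_(k < n) \sum_(z <- rs) z ^+ k - n%:R * (count_mem 1 rs)%:R| <= B.
Proof.
elim: rs => [|z rs IH] hrs.
  by exists 0 => n; rewrite mulr0 subr0 big1 ?normr0 // => k _; rewrite big_nil.
have [B hB] : exists B : C, forall n,
    `|\sum_(k < n) \sum_(z <- rs) z ^+ k - n%:R * (count_mem 1 rs)%:R| <= B.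
  by apply: IH => y yrs; apply: hrs; rewrite inE yrs orbT.
have [D hD] : exists D : C, forall n,
    `|\sum_(k < n) z ^+ k - n%:R * (z == 1)%:R| <= D.
  have [->|zn1] := eqVneq z 1.
    exists 0 => n; rewrite mulr1 (eq_bigr (fun=> 1)) => [|k _]; last first.
      by rewrite expr1n.
    by rewrite sumr_const card_ord subrr normr0.
  exists (2 / `|z - 1|) => n; rewrite mulr0 subr0; apply: sum_geom_bound => //.
  by apply: hrs; rewrite inE eqxx.
exists (D + B) => n.
under eq_bigr => k _ do rewrite big_cons.
rewrite big_split /= natrD mulrDr opprD addrACA.
exact: le_trans (ler_normD _ _) (lerD (hD n) (hB n)).
Qed.

(* Perron's theorem via Cesaro means: averaging [p_k lam^-k] over [k < n]
   isolates the multiplicity of [lam], and since [p_k >= 0] it is dominated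
   by the average of [p_k] itself, which isolates the multiplicity of 1. *)
Lemma nonneg_power_sums_root1 (C : numFieldType) (rs : seq C) (lam : C) :
  (forall k, 0 <= \sum_(z <- rs) z ^+ k) ->
  (forall z, z \in rs -> `|z| <= 1) -> lam \in rs -> `|lam| = 1 ->
  (forall B : C, exists n : nat, ~~ (n%:R <= B)) -> 1 \in rs.
Proof.
move=> ppos hrs lamrs lam1 archi; apply/negPn/negP => n1rs.
have lam0 : lam != 0 by rewrite -normr_gt0 lam1.
have [B1 hB1] := power_sums_bound hrs.
have [|B2 hB2] := @power_sums_bound _ [seq z / lam | z <- rs].
  move=> _ /mapP[z zrs ->]; rewrite normrM normfV lam1 invr1 mulr1.
  exact: hrs.
have [n] := archi (B1 + B2); move/negP; apply.
move: (hB1 n); rewrite (count_memPn n1rs) mulr0 subr0 => hS.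
have hcount : 1 <= (count_mem 1 [seq z / lam | z <- rs])%:R :> C.
  rewrite ler1n -has_count; apply/hasP; exists 1 => //=.
  by apply/mapP; exists lam; rewrite ?divff.
apply: le_trans (_ : n%:R * (count_mem 1 [seq z / lam | z <- rs])%:R <= _).
  by rewrite ler_peMr.
move: (hB2 n) => hT.
have TS : `|\sum_(k < n) \sum_(z <- [seq z / lam | z <- rs]) z ^+ k|
    <= `|\sum_(k < n) \sum_(z <- rs) z ^+ k|.
  rewrite [X in _ <= X]ger0_norm; last by apply: sumr_ge0 => k _.
  apply: le_trans (ler_norm_sum _ _ _) _; apply: ler_sum => k _.
  rewrite big_map (eq_bigr (fun z => z ^+ k / lam ^+ k)); last first.
    by move=> z _; rewrite expr_div_n.
  rewrite -mulr_suml normrM normfV normrX lam1 expr1n invr1 mulr1 ger0_norm //.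
rewrite -[X in X <= _]ger0_norm ?mulr_ge0 //.
apply: le_trans (lerD (le_trans TS hS) hT).
by rewrite distrC -[X in `|X| <= _](subrK (\sum_(k < n)
  \sum_(z <- [seq z / lam | z <- rs]) z ^+ k)) addrC ler_normD.
Qed.

(** The roots are split off one at a time: [M^(k+1) X = z M^k X + M^k (M - z) X], and [(M - z) X] is
    annihilated by the remaining factors, so its images decay by induction. As [th] exceeds every
    modulus strictly, multiple roots cost only a larger constant. *)
Lemma horner_mx_decay (C : numFieldType) n (M X : 'M[C]_n.+1) (rs : seq C)
    (th : C) :
  0 <= th -> (forall z, z \in rs -> `|z| < th) ->
  horner_mx M (\prod_(z <- rs) ('X - z%:P)) * X = 0 ->
  exists K : C, forall k i j, `|(M ^+ k * X) i j| <= K * th ^+ k.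
Proof.
move=> th0; elim: rs X => [|z rs IH] X hrs.
  rewrite big_nil rmorph1 mul1r => ->; exists 0 => k i j.
  by rewrite mulr0 mxE normr0 mul0r.
have zth : `|z| < th by apply: hrs; rewrite inE eqxx.
rewrite big_cons mulrC rmorphM -mulrA => hX.
have [|K hK] := IH _ _ hX; first by move=> y yrs; apply: hrs; rewrite inE yrs orbT.
pose L := \sum_i \sum_j `|X i j|.
have L0 : 0 <= L by apply: sumr_ge0 => i _; apply: sumr_ge0.
have hL i j : `|X i j| <= L.
  rewrite /L (bigD1 i) //= (bigD1 j) //= -addrA lerDl addr_ge0 //.
    exact: sumr_ge0.
  by apply: sumr_ge0 => ? _; apply: sumr_ge0.
have K0 : 0 <= K.
  by have := hK 0%N ord0 ord0; rewrite expr0 mulr1; apply: le_trans.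
(* [D] bounds the entries at [k = 0] since [D >= L], and it propagates since [|z| D + K <= th D]. *)
pose D := L + K / (th - `|z|).
have dz : 0 < th - `|z| by rewrite subr_gt0.
exists D; elim=> [|k IHk] i j.
  rewrite expr0 mul1r mulr1; apply: le_trans (hL i j) _.
  by rewrite /D lerDl divr_ge0 // ltW.
have -> : (M ^+ k.+1 * X) i j =
    z * (M ^+ k * X) i j + (M ^+ k * (horner_mx M ('X - z%:P) * X)) i j.
  rewrite rmorphB /= horner_mx_X horner_mx_C mulrBl mulrBr.
  have -> : M ^+ k * (M * X) = M ^+ k.+1 * X by rewrite mulrA -exprSr.
  have -> : M ^+ k * (z%:M * X) = z *: (M ^+ k * X).
    by rewrite -mulmxE mul_scalar_mx -scalemxAr.
  by rewrite !mxE [RHS]addrC subrK.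
apply: le_trans (ler_normD _ _) _; rewrite normrM.
apply: le_trans (lerD (ler_wpM2l (normr_ge0 z) (IHk i j)) (hK k i j)) _.
rewrite mulrA -mulrDl exprS mulrA ler_wpM2r ?exprn_ge0 //.
rewrite -lerBrDl [D * th]mulrC -mulrBl /D mulrDr mulrC.
by rewrite [X in _ <= _ + X]mulrCA divff ?mulr1 ?gt_eqF // lerDr mulr_ge0 // ltW.
Qed.

Section ComplexNorm.
Local Open Scope complex_scope.

Lemma norm_real_complex (R : rcfType) (x : R) : `|x%:C| = `|x|%:C :> R[i].
Proof. by rewrite normc_def /= expr0n addr0 sqrtr_sqr. Qed.

Lemma norm_complexE (R : rcfType) (z : R[i]) : (complex.Re `|z|)%:C = `|z|.
Proof. by rewrite RRe_real // normr_real. Qed.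

Lemma strict_radius (R : rcfType) (rs : seq R[i]) :
  (forall z, z \in rs -> `|z| < 1) ->
  exists th : R, [/\ 0 <= th, th < 1 & forall z, z \in rs -> `|z| < th%:C].
Proof.
elim: rs => [|z rs IH] hrs; first by exists 0.
have [|th [th0 th1 hth]] := IH; first by move=> y yrs; apply: hrs; rewrite inE yrs orbT.
have z1 : `|z| < 1 by apply: hrs; rewrite inE eqxx.
have [t zt t1] : exists2 t : R, `|z| < t%:C & t < 1.
  exists ((complex.Re `|z| + 1) / 2).
    by rewrite -norm_complexE ltcR midf_lt // -ltcR norm_complexE.
  by rewrite midf_lt // -ltcR norm_complexE.
exists (Num.max th t); rewrite le_max th0 gt_max th1 t1; split=> // y.
rewrite inE => /predU1P[->|/hth yth].
  by apply: lt_le_trans zt _; rewrite lecR le_max lexx orbT.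
by apply: lt_le_trans yth _; rewrite lecR le_max lexx.
Qed.

Lemma map_exprmx (R S : nzRingType) (f : {rmorphism R -> S}) n (M : 'M[R]_n) k :
  map_mx f (M ^+ k) = map_mx f M ^+ k.
Proof.
by elim: k => [|k IH]; rewrite ?expr0 ?map_mx1 // !exprS -mulmxE map_mxM IH.
Qed.

Lemma mulmx_entry_bound (R : numDomainType) m n p (X : 'M[R]_(m, n))
    (Y : 'M[R]_(n, p)) (a b : R) :
  (forall i j, `|X i j| <= a) -> (forall i j, `|Y i j| <= b) ->
  forall i j, `|(X *m Y) i j| <= n%:R * (a * b).
Proof.
move=> hX hY i j; rewrite mxE; apply: le_trans (ler_norm_sum _ _ _) _.
apply: le_trans (_ : \sum_(k < n) a * b <= _).
  by apply: ler_sum => k _; rewrite normrM ler_pM.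
by rewrite sumr_const card_ord mulr_natl.
Qed.

Lemma mx_entry_bound (R : numDomainType) m n (X : 'M[R]_(m, n)) :
  exists2 a : R, 0 <= a & forall i j, `|X i j| <= a.
Proof.
exists (\sum_i \sum_j `|X i j|) => [|i j].
  by apply: sumr_ge0 => i _; apply: sumr_ge0.
rewrite (bigD1 i) //= (bigD1 j) //= -addrA lerDl addr_ge0 //.
  exact: sumr_ge0.
by apply: sumr_ge0 => ? _; apply: sumr_ge0.
Qed.

(* With [char_poly M = ('X - 1) * g], the limit is [g(M) / g(1)]. *)
Lemma power_limit (R : rcfType) n (M : 'M[R]_n.+1) (rs : seq R[i]) :
  char_poly (map_mx (real_complex R) M) =
    ('X - 1%:P) * \prod_(z <- rs) ('X - z%:P) ->
  (forall z, z \in rs -> `|z| < 1) ->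
  exists (E : 'M[R]_n.+1) (th K : R),
    [/\ 0 <= th < 1, M * E = E, E * M = E, E * E = E &
      forall k i j, `|(M ^+ k - E) i j| <= K * th ^+ k].
Proof.
move=> hchar hrs; have [th [th0 th1 hth]] := strict_radius hrs.
pose rc := real_complex R.
have r1 : root (char_poly M) 1.
  rewrite -(fmorph_root rc) map_char_poly hchar rmorph1.
  by rewrite rootM root_XsubC eqxx.
have [g Eg] : exists g, char_poly M = g * ('X - 1%:P) by apply/factor_theorem.
have Cg : map_poly rc g = \prod_(z <- rs) ('X - z%:P).
  have h := hchar; rewrite -map_char_poly Eg rmorphM /= map_polyXsubC rmorph1 in h.
  by move: h; rewrite mulrC => /mulfI; apply; rewrite polyXsubC_eq0.
have g1 : g.[1] != 0.
  rewrite -(fmorph_eq0 rc) -horner_map Cg horner_prod rmorph1.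
  rewrite prodf_seq_neq0; apply/allP => z zrs /=.
  rewrite !hornerE subr_eq0; apply: contraTneq (hrs z zrs) => <-.
  by rewrite normr1 ltxx.
pose E := g.[1]^-1 *: horner_mx M g.
have CH : horner_mx M g * (M - 1) = 0.
  have := Cayley_Hamilton M; rewrite Eg rmorphM rmorphB /= horner_mx_X.
  by rewrite horner_mx_C.
have MC : M * horner_mx M g = horner_mx M g * M.
  have : horner_mx M ('X * g) = horner_mx M (g * 'X) by rewrite mulrC.
  by rewrite !rmorphM /= horner_mx_X.
have gM : horner_mx M g * M = horner_mx M g.
  by apply/eqP; rewrite -subr_eq0 -[X in _ - X]mulr1 -mulrBr CH.
have EM : E * M = E by rewrite /E -scalerAl gM.
have ME : M * E = E by rewrite /E -scalerAr MC gM.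
(* As [g - g(1)] vanishes at 1, [1 - E] is a multiple of [M - 1]. Hence [M^k - E = M^k (1 - E)]
   inherits the decay of [M^k (M - 1)], which holds because [g(M)] annihilates [M - 1]. *)
have [h Eh] : exists h, g - g.[1]%:P = h * ('X - 1%:P).
  by apply/factor_theorem; rewrite /root !hornerE subrr.
have E1 : 1 - E = (M - 1) * (- g.[1]^-1 *: horner_mx M h).
  have : horner_mx M (g - g.[1]%:P) = horner_mx M h * (M - 1).
    by rewrite Eh rmorphM rmorphB /= horner_mx_X horner_mx_C.
  have -> : horner_mx M h * (M - 1) = (M - 1) * horner_mx M h.
    have -> : M - 1 = horner_mx M ('X - 1%:P).
      by rewrite rmorphB /= horner_mx_X horner_mx_C.
    by rewrite -!rmorphM mulrC.
  rewrite rmorphB /= horner_mx_C => e; rewrite -scalerAr -e scaleNr scalerBr.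
  rewrite opprB; congr (_ - _).
  by rewrite -mul_scalar_mx -scalar_mxM mulVf.
have gE : E * E = E.
  suff : E * (1 - E) = 0 by rewrite mulrBr mulr1 => /eqP; rewrite subr_eq0 => /eqP.
  by rewrite E1 mulrA mulrBr EM mulr1 subrr mul0r.
have MkE k : M ^+ k * E = E.
  by elim: k => [|k IH]; rewrite ?expr0 ?mul1r // exprSr -mulrA ME.
have [||Kc hKc] := @horner_mx_decay R[i] n (map_mx rc M)
    (map_mx rc (M - 1)) rs th%:C _ hth.
- by rewrite ler0c.
- rewrite -Cg -map_horner_mx -mulmxE -map_mxM.
  by rewrite (_ : _ *m _ = 0) ?map_mx0 //; exact: CH.
pose K0 := complex.Re Kc.
have EKc : Kc = K0%:C.
  rewrite /K0 RRe_real // realE; apply/orP; left.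
  by have := hKc 0%N ord0 ord0; rewrite expr0 mulr1; apply: le_trans.
have hK0 k i j : `|(M ^+ k * (M - 1)) i j| <= K0 * th ^+ k.
  rewrite -lecR rmorphM rmorphXn /= -EKc -norm_real_complex.
  by have := hKc k i j; rewrite -map_exprmx -mulmxE -map_mxM mxE.
have [b b0 hb] := mx_entry_bound (- g.[1]^-1 *: horner_mx M h).
exists E, th, (n.+1%:R * (K0 * b)); split=> // [|k i j]; first by rewrite th0.
have -> : M ^+ k - E = (M ^+ k * (M - 1)) *m (- g.[1]^-1 *: horner_mx M h).
  by rewrite mulmxE -mulrA -E1 mulrBr mulr1 MkE.
apply: le_trans (mulmx_entry_bound (hK0 k) hb i j) _.
by rewrite mulrAC !mulrA.
Qed.

End ComplexNorm.

Section MxNorm.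
Context {R : realType}.

Lemma mx_norm_entry m n (X : 'M[R]_(m, n)) i j : `|X i j| <= `|X|.
Proof.
rewrite [leRHS]mx_normrE.
exact: (le_bigmax _ (fun ij => `|X ij.1 ij.2|) (i, j)).
Qed.

Lemma mx_norm_le m n (X : 'M[R]_(m, n)) e :
  0 <= e -> (forall i j, `|X i j| <= e) -> `|X| <= e.
Proof. by move=> e0 h; rewrite [leLHS]mx_normrE; apply: bigmax_le => // -[i j] _. Qed.

Lemma mx_normM m n p (X : 'M[R]_(m, n)) (Y : 'M[R]_(n, p)) :
  `|X *m Y| <= n%:R * (`|X| * `|Y|).
Proof.
apply: mx_norm_le => [|i j]; first by rewrite !mulr_ge0.
by apply: mulmx_entry_bound => *; apply: mx_norm_entry.
Qed.

Lemma expr_small (th e : R) : 0 <= th < 1 -> 0 < e ->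
  exists N, forall k, (N <= k)%N -> th ^+ k <= e.
Proof.
move=> /andP[th0 th1] e0.
have /cvgrPdist_le/(_ e e0)[N _ hN] : (fun k => th ^+ k) @ \oo --> (0 : R).
  by apply: cvg_expr; rewrite ger0_norm.
exists N => k Nk; have := hN k Nk.
by rewrite sub0r normrN ger0_norm ?exprn_ge0.
Qed.

Lemma scaled_expr_small (K th e : R) : 0 <= th < 1 -> 0 < e ->
  exists N, forall k, (N <= k)%N -> K * th ^+ k <= e.
Proof.
move=> hth e0; pose L := `|K| + 1; have L0 : 0 < L by rewrite ltr_wpDl.
have [N hN] := expr_small hth (divr_gt0 e0 L0).
exists N => k /hN h; apply: (@le_trans _ _ (L * th ^+ k)).
  rewrite ler_wpM2r ?exprn_ge0 ?(andP hth).1 //.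
  by rewrite (le_trans (ler_norm K)) // lerDl.
by rewrite -ler_pdivlMl // mulrC.
Qed.

(** The factors of a rank factorization have one-sided inverses; cancelling them in [c r c r = c r]
    leaves [r c = 1]. *)
Lemma idempotent_factor n (E : 'M[R]_n) : E *m E = E ->
  exists k (c : 'M[R]_(n, k)) (r : 'M[R]_(k, n)), E = c *m r /\ r *m c = 1%:M.
Proof.
move=> EE; exists (\rank E), (col_base E), (row_base E).
have := mulmx_base E; have := col_base_full E; have := row_base_free E.
move: (\rank E) (col_base E) (row_base E) => k c r.
move=> /row_freeP[D hD] /row_fullP[B hB] EB; split=> //.
have : B *m (E *m E) *m D = B *m E *m D by rewrite EE.
by rewrite -EB !mulmxA hB !mul1mx -!mulmxA hD mulmx1.
Qed.

(** The powers converge to an idempotent [E], which is non-negative as a limit of non-negative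
    matrices. Its trace is the limit of the traces of the powers, namely 1; the trace of an
    idempotent is its rank, so [E] has rank one. *)
Lemma perron_projection n (M : 'M[R]_n.+1) (rs : seq R[i]) :
  mx_nonneg M ->
  char_poly (complexify M) = ('X - 1%:P) * \prod_(z <- rs) ('X - z%:P) ->
  (forall z, z \in rs -> `|z| < 1) ->
  (forall k, \tr (complexify M ^+ k) = 1 + \sum_(z <- rs) z ^+ k) ->
  exists (v : 'cV[R]_n.+1) (r : 'rV[R]_n.+1),
    [/\ mx_nonneg v, mx_nonneg r, r *m v = 1%:M, M *m v = v /\ r *m M = r &
     forall e, 0 < e -> exists N, forall k, (N <= k)%N -> `|M ^+ k - v *m r| <= e].
Proof.
move=> M0 hchar hrs htr.
have [E [th [K [hth ME EM EE hE]]]] := power_limit hchar hrs.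
have Mk0 k : mx_nonneg (M ^+ k).
  elim: k => [|k IH] i j; first by rewrite expr0 mxE ler0n.
  by rewrite exprS mxE sumr_ge0 // => l _; rewrite mulr_ge0.
have hlim e : 0 < e -> exists N, forall k, (N <= k)%N -> `|M ^+ k - E| <= e.
  move=> e0; have [N hN] := scaled_expr_small K hth e0.
  exists N => k /hN hk; apply: mx_norm_le => [|i j]; first exact: ltW.
  exact: le_trans (hE k i j) hk.
have E0 : mx_nonneg E.
  move=> i j; rewrite -[X in _ <= X]addr0; apply/ler_addgt0Pr => e e0.
  rewrite addr0; have [N /(_ N (leqnn N)) hN] := hlim e e0.
  have := le_trans (mx_norm_entry (M ^+ N - E) i j) hN.
  rewrite !mxE ler_norml => /andP[_]; rewrite lerBlDr addrC.
  exact: le_trans (Mk0 N i j).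
have [s [hs1 hs2 hs3]] := strict_radius hrs.
have trE : \tr E = 1.
  apply/eqP; rewrite -subr_eq0 -normr_le0.
  apply/ler_addgt0Pr => e e0; rewrite add0r.
  have e20 : 0 < e / 2 by rewrite divr_gt0.
  have [N1 hN1] := scaled_expr_small (n.+1%:R * K) hth e20.
  have [|N2 hN2] := @scaled_expr_small (size rs)%:R s _ _ e20.
    by rewrite hs1.
  pose k := maxn N1 N2.
  have h1 : `|\tr E - \tr (M ^+ k)| <= e / 2.
    rewrite -raddfB /= /mxtrace; apply: le_trans (ler_norm_sum _ _ _) _.
    apply: le_trans (hN1 k (leq_maxl _ _)).
    rewrite -mulrA mulr_natl -[n.+1 in X in _ <= X]card_ord -sumr_const.
    by apply: ler_sum => i _; have := hE k i i; rewrite !mxE distrC.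
  have h2 : `|\tr (M ^+ k) - 1| <= e / 2.
    apply: le_trans (hN2 k (leq_maxr _ _)).
    rewrite -lecR -norm_real_complex rmorphB rmorph1 /=.
    rewrite -[X in `|X - _|]trace_map_mx /= map_exprmx htr addrC addKr.
    apply: le_trans (ler_norm_sum _ _ _) _.
    rewrite rmorphM rmorph_nat rmorphXn /=.
    apply: le_trans (_ : \sum_(z <- rs) s%:C%C ^+ k <= _).
      rewrite big_seq [X in _ <= X]big_seq; apply: ler_sum => z /hs3 hz.
      by rewrite normrX lerXn2r ?nnegrE // ?ler0c // ltW.
    by rewrite big_const_seq count_predT iter_addr_0 mulr_natl.
  by rewrite [e]splitr; apply: le_trans (ler_distD (\tr (M ^+ k)) _ _) (lerD h1 h2).
have [k [c [r [Ecr rc]]]] := idempotent_factor EE.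
have k1 : k = 1%N.
  have := trE; rewrite Ecr mxtrace_mulC rc mxtrace1 => /eqP.
  by rewrite pnatr_eq1 => /eqP.
subst k.
(* The factors [c] and [r] may have mixed signs; since their product is non-negative, absolute
   values do not change it. *)
pose v : 'cV[R]_n.+1 := \col_i `|c i 0|; pose u : 'rV[R]_n.+1 := \row_i `|r 0 i|.
have Evu : E = v *m u.
  apply/matrixP => i j; have := E0 i j; rewrite Ecr !mxE !big_ord1 !mxE => cr.
  by rewrite -normrM ger0_norm.
have uv : u *m v = 1%:M.
  have : \tr (u *m v) = 1 by rewrite mxtrace_mulC -Evu.
  by rewrite /mxtrace big_ord1 => h; apply/matrixP => i j; rewrite !ord1 h mxE.
exists v, u; split.
- by move=> i j; rewrite mxE.
- by move=> i j; rewrite mxE.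
- by [].
- have vE : E *m v = v by rewrite Evu -mulmxA uv mulmx1.
  have uE : u *m E = u by rewrite Evu mulmxA uv mul1mx.
  split; first by rewrite -[in LHS]vE mulmxA mulmxE ME vE.
  by rewrite -[in LHS]uE -mulmxA mulmxE EM uE.
- by move=> e e0; have [N hN] := hlim e e0; exists N => k Nk; rewrite -Evu hN.
Qed.
End MxNorm.

(** * Long products *)

Section WordLemmas.
Context {m : nat}.
Implicit Types u v w s : seq 'I_m.

(** These are the words exempted from the spectral gap when [w] is the unique dominant product. *)
Definition dominated w s := exists i k, s = word_pow (rot i w) k.

Lemma size_word_pow w k : size (word_pow w k) = (k * size w)%N.
Proof. by rewrite size_flatten /shape map_nseq sumn_nseq mulnC. Qed.

Lemma word_powD w j k : word_pow w (j + k) = word_pow w j ++ word_pow w k.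
Proof. by rewrite /word_pow nseqD flatten_cat. Qed.

Lemma word_powS w k : word_pow w k.+1 = w ++ word_pow w k.
Proof. by []. Qed.

Lemma word_powSr w k : word_pow w k.+1 = word_pow w k ++ w.
Proof. by rewrite -addn1 word_powD -[word_pow w 1]/(w ++ [::]) cats0. Qed.

Lemma word_pow_shift (x y : seq 'I_m) k : 
  word_pow (y ++ x) k.+1 = y ++ word_pow (x ++ y) k ++ x.
Proof.
elim: k => [|k IH]; first by rewrite -[LHS]/((y ++ x) ++ [::]) cats0.
by rewrite word_powS IH word_powS -!catA.
Qed.

Lemma rot_split w i : exists x y, w = x ++ y /\ rot i w = y ++ x.
Proof. by exists (take i w), (drop i w); rewrite cat_take_drop. Qed.

(** For [w = x ++ y], a power of the rotation [y ++ x] contains one copy of [w] fewer, whence [K.+1]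
    in the size bound. *)
Lemma dominated_long w s K : dominated w s -> (K.+1 * size w <= size s)%N ->
  w <> [::] -> exists a b, s = a ++ word_pow w K ++ b.
Proof.
move=> [i [k ->]] + wne; have [x [y [Ew ->]]] := rot_split w i.
rewrite size_word_pow size_cat addnC -size_cat -Ew leq_pmul2r; last first.
  by case: (w) wne.
case: k => // k Kk; exists y, (word_pow w (k - K) ++ x).
by rewrite word_pow_shift -Ew -[in LHS](subnKC (Kk : (K <= k)%N)) word_powD -catA.
Qed.

(** Comparing the last [size w] letters shows that the rotation is [w] itself; the common copies of
    [w] then cancel. *)
Lemma dominated_catr w b k : dominated w (b ++ word_pow w k.+1) -> w <> [::] ->
  exists j, b = word_pow w j.
Proof.
move=> [i [l E]] wne.
have wpos : (0 < size w)%N by case: (w) wne.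
have := congr1 size E; rewrite size_cat !size_word_pow size_rot => Es.
have kl : (k.+1 <= l)%N by rewrite -(leq_pmul2r wpos) -Es leq_addl.
case: l E Es kl => // l E Es kl.
have [_ rw] : b ++ word_pow w k = word_pow (rot i w) l /\ w = rot i w.
  have := E; rewrite !word_powSr catA => /eqP; rewrite eqseq_cat.
    by move=> /andP[/eqP ? /eqP ?].
  apply/eqP; rewrite -(eqn_add2r (size w)) size_cat !size_word_pow size_rot.
  by rewrite -addnA -mulSnr Es mulSnr.
exists (l.+1 - k.+1)%N; move: E; rewrite -rw -[in RHS](subnK kl) word_powD.
move=> /eqP; rewrite eqseq_cat; first by move=> /andP[/eqP ? _].
apply/eqP; rewrite -(eqn_add2r (k.+1 * size w)) Es size_word_pow -mulnDl.
by rewrite subnK.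
Qed.
End WordLemmas.

Section WordProd.
Context {R : realType} {d m : nat}.
Implicit Types (A : 'I_m -> 'M[R]_d).

Lemma word_prod_nil A : word_prod A [::] = 1%:M.
Proof. by rewrite /word_prod big_nil. Qed.

Lemma word_prod_cons A j u : word_prod A (j :: u) = A j *m word_prod A u.
Proof. by rewrite /word_prod big_cons. Qed.

Lemma word_prod_cat A a b : word_prod A (a ++ b) = word_prod A a *m word_prod A b.
Proof. by rewrite /word_prod big_cat. Qed.

Lemma word_prod_pow A w k : word_prod A (word_pow w k) = word_prod A w ^+ k.
Proof.
elim: k => [|k IH]; first by rewrite word_prod_nil.
by rewrite word_powS word_prod_cat IH exprS.
Qed.

Lemma mx_nonnegM p q s (X : 'M[R]_(p, q)) (Y : 'M[R]_(q, s)) :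
  mx_nonneg X -> mx_nonneg Y -> mx_nonneg (X *m Y).
Proof. by move=> hX hY i j; rewrite mxE sumr_ge0 // => k _; rewrite mulr_ge0. Qed.

Lemma word_prod_nonneg A u : family_nonneg A -> mx_nonneg (word_prod A u).
Proof.
move=> A0; elim: u => [|j u IH]; last by rewrite word_prod_cons; apply: mx_nonnegM.
by rewrite word_prod_nil => i j; rewrite mxE ler0n.
Qed.

(* [B] stands for the family divided by [nu A w], with the leading eigenvectors
   [v] (right) and [r] (left) of the product of [w]; the notion is self-dual. *)
Record core (B : 'I_m -> 'M[R]_d) (w : seq 'I_m) (v : 'cV[R]_d) (r : 'rV[R]_d)
  : Prop := Core {
  core_nonneg : family_nonneg B;
  core_irr : positively_irreducible B;
  core_wne : w <> [::];
  core_bdd : exists C, forall u, `|word_prod B u| <= C;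
  core_gap : exists2 sg, 0 < sg & forall s, s <> [::] -> ~ dominated w s ->
    sg <= `|\det (1%:M - word_prod B s)|;
  core_v0 : mx_nonneg v;
  core_r0 : mx_nonneg r;
  core_rv : r *m v = 1%:M;
  core_wv : word_prod B w *m v = v;
  core_rw : r *m word_prod B w = r;
  core_lim : forall e, 0 < e -> exists N, forall k, (N <= k)%N ->
    `|word_prod B w ^+ k - v *m r| <= e }.
End WordProd.

Section AdjBound.
Context {R : realType}.

Lemma det_bound n (M : 'M[R]_n) a : (forall i j, `|M i j| <= a) ->
  `|\det M| <= n`!%:R * a ^+ n.
Proof.
move=> hM; apply: le_trans (ler_norm_sum _ _ _) _.
apply: le_trans (_ : \sum_(s : {perm 'I_n}) a ^+ n <= _).
  apply: ler_sum => s _; rewrite normrM normrX normrN normr1 expr1n mul1r.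
  rewrite normr_prod -[n in a ^+ n]card_ord -prodr_const.
  by apply: ler_prod => i _; rewrite normr_ge0 hM.
by rewrite sumr_const -[n in n`!]card_ord -card_Sn card_ord mulr_natl.
Qed.

Lemma adj_bound n (M : 'M[R]_n) a : 0 <= a -> `|M| <= a ->
  `|\adj M| <= n.-1`!%:R * a ^+ n.-1.
Proof.
move=> a0 hM; apply: mx_norm_le => [|i j]; first by rewrite mulr_ge0 ?exprn_ge0.
rewrite mxE /cofactor normrM normrX normrN normr1 expr1n mul1r.
apply: det_bound => k l; rewrite !mxE; exact: le_trans (mx_norm_entry _ _ _) hM.
Qed.
End AdjBound.

Section Dynamics.
Context {R : realType} {d m : nat}.
Variables (B : 'I_m -> 'M[R]_d) (w : seq 'I_m) (v : 'cV[R]_d) (r : 'rV[R]_d).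
Hypothesis coreB : core B w v r.
Local Notation W := (word_prod B).

Lemma core_bound : exists2 C, 0 < C & forall u, `|W u| <= C.
Proof.
have [C hC] := core_bdd coreB; exists (`|C| + 1) => [|u]; first by rewrite ltr_wpDl.
by rewrite (le_trans (hC u)) // (le_trans (ler_norm C)) // lerDl.
Qed.

(** Multiplying [x - x *m W s] by the adjugate of [1 - W s] gives [det(1 - W s) x]. The determinant
    is bounded below by [core_gap], and the adjugate is bounded because the products are. *)
Lemma gap_row : exists2 tau, 0 < tau &
  forall s, s <> [::] -> ~ dominated w s ->
  forall n (x : 'M[R]_(n, d)), tau * `|x| <= `|x - x *m W s|.
Proof.
have [C C0 hC] := core_bound; have [sg sg0 hsg] := core_gap coreB.
pose a := `|1%:M : 'M[R]_d| + C.
pose D := d%:R * (d.-1`!%:R * a ^+ d.-1) + 1.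
have a0 : 0 <= a by rewrite addr_ge0 // ltW.
have D0 : 0 < D by rewrite ltr_wpDl // !mulr_ge0 ?exprn_ge0.
exists (sg / D) => [|s sne ndom n x]; first by rewrite divr_gt0.
rewrite mulrAC ler_pdivrMr //.
apply: (@le_trans _ _ (`|\det (1%:M - W s)| * `|x|)).
  by rewrite ler_wpM2r // hsg.
rewrite -normrZ -[x in _ *: x]mulmx1 -mul_mx_scalar.
have -> : x *m 1%:M *m (\det (1%:M - W s))%:M =
    (x - x *m W s) *m \adj (1%:M - W s).
  by rewrite -mul_mx_adj mulmxA mulmx1 mulmxBr mulmx1.
apply: le_trans (mx_normM _ _) _; rewrite mulrCA ler_wpM2l //.
apply: (@le_trans _ _ (d%:R * (d.-1`!%:R * a ^+ d.-1))); last by rewrite /D lerDl.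
rewrite ler_wpM2l //; apply: adj_bound => //.
by rewrite (le_trans (ler_normB _ _)) // /a lerD2l.
Qed.

(* Pigeonhole on the prefix products: two that are close to each other are
   separated by a factor that almost fixes a vector, hence by a power of a
   rotation of [w]. *)
Lemma long_word_factor K (dl : R) : 0 < dl ->
  exists N, forall u, (N <= size u)%N -> dl < `|W u| ->
  exists a b, u = a ++ word_pow w K ++ b.
Proof.
move=> dl0; have [C C0 hC] := core_bound; have [tau tau0 htau] := gap_row.
have wpos : (0 < size w)%N by have := core_wne coreB; case: (w).
pose D := d%:R * C + 1; have D0 : 0 < D by rewrite ltr_wpDl // mulr_ge0 // ltW.
pose dl' := dl / D; have dl'0 : 0 < dl' by rewrite divr_gt0.
(* Half of the distance that [gap_row] guarantees for a matrix of norm at least [dl'], so that two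
   [eta]-close prefixes contradict it. *)
have [eta eta0 Eeta] : exists2 eta, 0 < eta & 2 * eta = tau * dl'.
  by exists (tau * dl' / 2); [rewrite divr_gt0 // mulr_gt0 | rewrite mulrC divfK].
pose L := Num.truncn (C / eta).
(* The entries of products lie in [[0, C]]; rounding them down to multiples of [eta] leaves finitely
   many codes, and equal codes mean distance at most [eta]. *)
pose code (P : 'M[R]_d) := [ffun ij : 'I_d * 'I_d =>
  inord (Num.truncn (P ij.1 ij.2 / eta)) : 'I_L.+1].
pose M := #|{ffun 'I_d * 'I_d -> 'I_L.+1}|.
(* Only prefixes whose length is a multiple of [K'] are compared, so the factor between two of them
   is long enough for [dominated_long]. *)
pose K' := (K.+1 * size w)%N; have K'0 : (0 < K')%N by rewrite muln_gt0.
have codeP u1 u2 : code (W u1) = code (W u2) -> `|W u1 - W u2| <= eta.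
  move=> /ffunP h; apply: mx_norm_le => [|i j]; first exact: ltW.
  have := h (i, j); rewrite !ffunE /= => /(congr1 (@nat_of_ord _)).
  have trL u : (Num.truncn (W u i j / eta) < L.+1)%N.
    rewrite ltnS; apply: le_truncn; rewrite ler_pM2r ?invr_gt0 //.
    exact: le_trans (ler_norm _) (le_trans (mx_norm_entry _ _ _) (hC u)).
  rewrite !inordK // => e.
  have ge0 u : 0 <= W u i j / eta.
    by rewrite divr_ge0 ?(ltW eta0) //; exact: (word_prod_nonneg u (core_nonneg coreB)).
  have /andP[a1 a2] := truncn_itv (ge0 u1).
  have /andP[b1 b2] := truncn_itv (ge0 u2).
  rewrite e in a1 a2; move: a1 a2 b1 b2; rewrite -natr1.
  set t := _%:R; rewrite !ler_pdivlMr // !ltr_pdivrMr // => a1 a2 b1 b2.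
  rewrite !mxE ler_norml; apply/andP; split; lra.
exists (M * K')%N => u Mu ndl.
pose P (p : 'I_M.+1) := take (p * K') u.
have /injectivePn[p0 [q0 npq0 Epq0]] : ~~ injectiveb (fun p => code (W (P p))).
  apply/negP => /injectiveP inj; have := leq_card _ inj.
  by rewrite card_ord -/M ltnn.
have [p [q [pq Epq]]] : exists p q : 'I_M.+1,
    (p < q)%N /\ code (W (P p)) = code (W (P q)).
  move: npq0; rewrite -val_eqE neq_ltn => /orP[h|h]; first by exists p0, q0.
  by exists q0, p0.
pose s := drop (p * K') (P q).
have Eq : P q = P p ++ s.
  rewrite /P /s -[LHS](cat_take_drop (p * K')) take_takel //.
  by rewrite leq_mul2r ltnW ?orbT.
have qu : (q * K' <= size u)%N.
  by apply: leq_trans Mu; rewrite leq_mul2r -ltnS ltn_ord orbT.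
have ss : (K' <= size s)%N.
  by rewrite /s size_drop size_takel // -mulnBl leq_pmull // subn_gt0.
have sne : s <> [::] by move=> s0; move: ss; rewrite s0 leqNgt K'0.
(* No prefix is small: the rest of the word has a bounded product, while the whole product exceeds
   [dl]. *)
have Pp : dl' <= `|W (P p)|.
  rewrite /dl' ler_pdivrMr //; apply: le_trans (ltW ndl) _.
  rewrite -[u](cat_take_drop (p * K')) word_prod_cat -/(P p).
  apply: le_trans (mx_normM _ _) _; rewrite mulrCA ler_wpM2l //.
  by rewrite /D (le_trans (ler_wpM2l _ (hC _))) // lerDl.
have [a [b Es]] : exists a b, s = a ++ word_pow w K ++ b.
  apply: dominated_long => //; last exact: core_wne coreB.
  apply: contrapT => ndom; have := htau s sne ndom _ (W (P p)).
  rewrite -word_prod_cat -Eq => h.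
  have := le_trans h (codeP _ _ Epq).
  have := ler_wpM2l (ltW tau0) Pp; have := mulr_gt0 tau0 dl'0; lra.
exists (P p ++ a), (b ++ drop (q * K') u).
by rewrite -[LHS](cat_take_drop (q * K')) -/(P q) Eq Es -!catA.
Qed.

Lemma core_lim_mul p q (X : 'M[R]_(p, d)) (Y : 'M[R]_(d, q)) e : 0 < e ->
  exists N, forall k, (N <= k)%N ->
  `|X *m W w ^+ k *m Y - X *m v *m (r *m Y)| <= e.
Proof.
move=> e0; pose D := d%:R * (d%:R * `|X|) * `|Y| + 1.
have D0 : 0 < D by rewrite ltr_wpDl // !mulr_ge0.
have [N hN] := core_lim coreB (divr_gt0 e0 D0); exists N => k /hN hk.
rewrite !mulmxA -mulmxBl -[X *m v *m r]mulmxA -mulmxBr.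
apply: le_trans (mx_normM _ _) _.
apply: (@le_trans _ _ (D * `|W w ^+ k - v *m r|)); last first.
  by rewrite mulrC -ler_pdivlMr.
apply: (@le_trans _ _ (d%:R * (d%:R * (`|X| * `|W w ^+ k - v *m r|) * `|Y|))).
  by rewrite ler_wpM2l // ler_wpM2r // mx_normM.
rewrite [leLHS](_ : _ = d%:R * (d%:R * `|X|) * `|Y| * `|W w ^+ k - v *m r|).
  by rewrite ler_wpM2r // /D lerDl.
by rewrite !mulrA mulrAC.
Qed.

(** A long product that is not small contains a high power of [w], which may be replaced by its
    limit [v *m r]. The exponent [K.+1] makes [a] strictly shorter than [u], as later inductions on
    the length require. *)
Lemma approx_word e : 0 < e -> exists N, forall u, (N <= size u)%N ->
  `|W u| <= e \/ exists a b K, [/\ u = a ++ word_pow w K.+1 ++ b &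
    `|W u - W a *m v *m (r *m W b)| <= e].
Proof.
move=> e0; have [C C0 hC] := core_bound.
pose D := d%:R * (d%:R * C) * C + 1.
have D0 : 0 < D by rewrite ltr_wpDl // !mulr_ge0 // ltW.
have [K hK] := core_lim coreB (divr_gt0 e0 D0).
have [N hN] := long_word_factor K.+1 e0; exists N => u /hN hu.
have [h|/hu [a [b Eu]]] := leP `|W u| e; [by left | right].
exists a, b, K; split=> //.
rewrite Eu 2!word_prod_cat word_prod_pow.
rewrite !mulmxA -mulmxBl -[W a *m v *m r]mulmxA -mulmxBr.
apply: le_trans (mx_normM _ _) _.
have hk := hK K.+1 (leqnSn K).
apply: (@le_trans _ _ (D * `|W w ^+ K.+1 - v *m r|)); last first.
  by rewrite mulrC -ler_pdivlMr.
apply: (@le_trans _ _ (d%:R * (d%:R * (C * `|W w ^+ K.+1 - v *m r|) * C))).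
  rewrite ler_wpM2l // ler_pM //; apply: le_trans (mx_normM _ _) _.
  by rewrite ler_wpM2l // ler_wpM2r.
rewrite [leLHS](_ : _ = d%:R * (d%:R * C) * C * `|W w ^+ K.+1 - v *m r|).
  by rewrite ler_wpM2r // /D lerDl.
by rewrite !mulrA mulrAC.
Qed.

(** The effect of a block [b] between two long powers of [w]: in the limit,
    [(v r) (W b) (v r) = weight b * (v r)]. *)
Definition weight b : R := (r *m W b *m v) 0 0.

Lemma weightE b : r *m W b *m v = (weight b)%:M.
Proof. by apply/matrixP => i j; rewrite !ord1 [RHS]mxE mulr1n. Qed.

Lemma weight_nil : weight [::] = 1.
Proof. by rewrite /weight word_prod_nil mulmx1 (core_rv coreB) mxE. Qed.

Lemma weight_ge0 b : 0 <= weight b.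
Proof.
have B0 := word_prod_nonneg b (core_nonneg coreB).
exact: (mx_nonnegM (mx_nonnegM (core_r0 coreB) B0) (core_v0 coreB)).
Qed.

(* Inserting [w ^ k] between two words multiplies their weights in the limit
   [k -> oo], while weights are bounded. *)
Lemma weight_le1 b : weight b <= 1.
Proof.
pose E := [set weight u | u in setT].
have [C C0 hC] := core_bound.
have supE : has_sup E.
  split; first by exists (weight [::]); exists [::].
  exists (d%:R * (d%:R * (`|r| * C) * `|v|)) => _ [u _ <-].
  apply: le_trans (ler_norm _) _.
  apply: le_trans (mx_norm_entry (r *m W u *m v) 0 0) _.
  apply: le_trans (mx_normM _ _) _; rewrite ler_wpM2l // ler_wpM2r //.
  by apply: le_trans (mx_normM _ _) _; rewrite ler_wpM2l // ler_wpM2l.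
have ubE u : weight u <= sup E by apply: ub_le_sup (supE.2) _ _; exists u.
have s1 : 1 <= sup E by rewrite -weight_nil.
have s0 : 0 < sup E by apply: lt_le_trans s1.
have prodE u : weight b * weight u <= sup E.
  apply/ler_addgt0Pr => e e0.
  have [N /(_ N (leqnn N)) hN] := core_lim_mul (r *m W b) (W u *m v) e0.
  have := le_trans (mx_norm_entry _ 0 0) hN.
  have -> : r *m W b *m W w ^+ N *m (W u *m v) =
      r *m W (b ++ word_pow w N ++ u) *m v.
    by rewrite !word_prod_cat word_prod_pow !mulmxA.
  rewrite [r *m (W u *m v)]mulmxA !weightE -scalar_mxM !mxE !mulr1n.
  rewrite ler_norml => /andP[+ _].
  by have := ubE (b ++ word_pow w N ++ u); lra.
rewrite -(ler_pM2r s0) mul1r mulrC.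
have [b0|b0] := eqVneq (weight b) 0; first by rewrite b0 mulr0 ltW.
have bp : 0 < weight b by rewrite lt_neqAle eq_sym b0 weight_ge0.
rewrite -ler_pdivlMr //; apply: ge_sup; first exact: supE.1.
by move=> _ [u _ <-]; rewrite ler_pdivlMr // mulrC.
Qed.

(** If [b] is not a power of [w], then [b ++ w^N] is not dominated for [N > 0], so [gap_row] keeps
    [r] away from its image under that product. The image tends to [weight b * r], and
    [weight b <= 1] turns the distance into a gap below 1. *)
Lemma weight_gap : exists2 tau, 0 < tau &
  forall b, (exists j, b = word_pow w j) \/ weight b <= 1 - tau.
Proof.
have [tau tau0 htau] := gap_row; exists tau => // b.
have [pw|npw] := pselect (exists j, b = word_pow w j); [by left|right].
have wne := core_wne coreB.
have r0 : 0 < `|r|.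
  rewrite normr_gt0; apply: contra_eq_neq (core_rv coreB) => ->.
  rewrite mul0mx; apply/eqP => /matrixP/(_ 0 0); rewrite !mxE => /eqP.
  by rewrite eq_sym oner_eq0.
have : tau * `|r| <= (1 - weight b) * `|r|.
  apply/ler_addgt0Pr => e e0.
  have [N /(_ N.+1 (leqnSn N)) hN] := core_lim_mul (r *m W b) (1%:M : 'M[R]_d) e0.
  have ndom : ~ dominated w (b ++ word_pow w N.+1).
    by move=> /dominated_catr/(_ wne).
  have ne : b ++ word_pow w N.+1 <> [::].
    by move: wne; case: (b); rewrite ?word_powS //; case: (w).
  apply: le_trans (htau _ ne ndom _ r) _.
  rewrite word_prod_cat word_prod_pow mulmxA.
  rewrite !mulmx1 weightE mul_scalar_mx in hN.
  set Z := r *m _ *m _ in hN *.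
  have -> : r - Z = (1 - weight b) *: r - (Z - weight b *: r).
    by rewrite scalerBl scale1r opprB addrA subrK.
  apply: le_trans (ler_normB _ _) _; apply: lerD => //.
  by rewrite normrZ ger0_norm // subr_ge0 weight_le1.
by rewrite ler_pM2r // lerBrDr addrC -lerBrDr.
Qed.

End Dynamics.

(** * Monotone convex sets and polytopes *)

Section MonoConvex.
Context {R : realType} {d : nat}.
Implicit Types (x y z p : 'cV[R]_d) (G H K : set 'cV[R]_d).

Lemma vle_refl x : vle x x. Proof. by move=> i. Qed.

Lemma vle_trans y x z : vle x y -> vle y z -> vle x z.
Proof. by move=> xy yz i; apply: le_trans (xy i) (yz i). Qed.

Lemma vle_antisym x y : vle x y -> vle y x -> x = y.
Proof.
by move=> xy yx; apply/colP => i; apply/eqP; rewrite eq_le xy yx.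
Qed.

Lemma vleD x y z t : vle x y -> vle z t -> vle (x + z) (y + t).
Proof. by move=> xy zt i; rewrite !mxE lerD. Qed.

Lemma vleZ (a : R) x y : 0 <= a -> vle x y -> vle (a *: x) (a *: y).
Proof. by move=> a0 xy i; rewrite !mxE ler_wpM2l. Qed.

Lemma vleM (M : 'M[R]_d) x y : mx_nonneg M -> vle x y -> vle (M *m x) (M *m y).
Proof. by move=> M0 xy i; rewrite !mxE ler_sum // => k _; rewrite ler_wpM2l. Qed.

Lemma cone0 : @cone R d 0. Proof. exact: vle_refl. Qed.

Lemma coneP x : cone x <-> forall i, 0 <= x i 0.
Proof. by split=> h i; have := h i; rewrite mxE. Qed.

Lemma cone_nonneg x : mx_nonneg x <-> cone x.
Proof.
rewrite coneP; split=> h i; first exact: h.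
by move=> j; rewrite ord1.
Qed.

Lemma coneD x y : cone x -> cone y -> cone (x + y).
Proof. by move=> /coneP x0 /coneP y0; apply/coneP => i; rewrite mxE addr_ge0. Qed.

Lemma coneZ (a : R) x : 0 <= a -> cone x -> cone (a *: x).
Proof. by move=> a0 /coneP x0; apply/coneP => i; rewrite mxE mulr_ge0. Qed.

Lemma coneM (M : 'M[R]_d) x : mx_nonneg M -> cone x -> cone (M *m x).
Proof. by move=> M0 /cone_nonneg x0; apply/cone_nonneg/mx_nonnegM. Qed.

Lemma convex_setE G : @convex_set R 'cV[R]_d G <->
  forall x y (a b : R), G x -> G y -> 0 <= a -> 0 <= b -> a + b = 1 ->
    G (a *: x + b *: y).
Proof.
split=> [cG x y a b Gx Gy a0 b0 ab|cG x y l].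
  have a1 : a <= 1 by rewrite -ab lerDl.
  have := cG x y (Itv01 a0 a1); rewrite !inE => /(_ Gx Gy).
  by have -> : b = 1 - a by rewrite -ab addrC addKr.
rewrite !inE => Gx Gy; apply: cG => //.
- by rewrite /unstable.onem subr_ge0.
- by rewrite /unstable.onem addrC subrK.
Qed.

(** Monotone bodies without the topological conditions: every [mono_hull] has these properties and
    is minimal among such sets. *)
Definition mono_convex G :=
  [/\ @convex_set R 'cV[R]_d G, G `<=` cone
    & forall x y, G x -> cone y -> vle y x -> G y].

(** A total weight below 1 is allowed: raising the second weight to [1 - a] only enlarges the
    point. *)
Lemma mono_convex_comb G x y (a b : R) : mono_convex G -> G x -> G y ->
  0 <= a -> 0 <= b -> a + b <= 1 -> G (a *: x + b *: y).
Proof.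
move=> [/convex_setE cG Gc dG] Gx Gy a0 b0 ab.
have cx := Gc _ Gx; have cy := Gc _ Gy.
apply: (dG (a *: x + (1 - a) *: y)).
- by apply: cG => //; [rewrite subr_ge0; lra | rewrite addrC subrK].
- by apply: coneD; apply: coneZ.
- apply: vleD (@vle_refl _) _ => i; have /coneP yi := cy.
  by rewrite !mxE ler_wpM2r // lerBrDl.
Qed.

Lemma conv_hull_convex K : @convex_set R 'cV[R]_d (conv_hull K).
Proof.
move=> x y l; rewrite !inE => hx hy M [cM KM].
have := cM x y l; rewrite !inE; apply; [exact: hx|exact: hy].
Qed.

Lemma mono_hull_mono_convex K : mono_convex (mono_hull K).
Proof.
have /convex_setE cK := @conv_hull_convex K.
split.
- apply/convex_setE => x y a b [cx [x' hx' xx']] [cy [y' hy' yy']] a0 b0 ab.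
  split; first by apply: coneD; apply: coneZ.
  by exists (a *: x' + b *: y'); [exact: cK | apply: vleD; apply: vleZ].
- by move=> x [].
- move=> x y [cx [x' hx' xx']] cy yx; split=> //; exists x' => //.
  exact: vle_trans yx xx'.
Qed.

Lemma sub_mono_hull K : K `<=` cone -> K `<=` mono_hull K.
Proof.
move=> Kc x Kx; split; first exact: Kc.
by exists x => //; apply: sub_gen_smallest.
Qed.

(** This serves as the induction principle for hulls: a property defining a monotone convex set,
    such as a preimage or a half-space, is checked on generators only. *)
Lemma mono_hull_min K G : mono_convex G -> K `<=` G -> mono_hull K `<=` G.
Proof.
move=> [cG Gc dG] KG y [cy [x hx yx]]; apply: (dG x) => //.
exact: (smallest_sub cG KG).
Qed.

Lemma mono_hull_id G : mono_convex G -> mono_hull G = G.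
Proof.
move=> mG; apply/seteqP; split; first exact: mono_hull_min.
by apply: sub_mono_hull; case: mG.
Qed.

Lemma mono_hull_eq K H : K `<=` mono_hull H -> H `<=` mono_hull K ->
  mono_hull K = mono_hull H.
Proof.
move=> KH HK; apply/seteqP; split; apply: mono_hull_min => //;
exact: mono_hull_mono_convex.
Qed.

Lemma mono_convex_preim (M : 'M[R]_d) G : mx_nonneg M -> mono_convex G ->
  mono_convex [set x | cone x /\ G (M *m x)].
Proof.
move=> M0 [/convex_setE cG Gc dG]; split.
- apply/convex_setE => x y a b [cx Gx] [cy Gy] a0 b0 ab; split.
    by apply: coneD; apply: coneZ.
  by rewrite mulmxDr -!scalemxAr; apply: cG.
- by move=> x [].
- move=> x y [cx Gx] cy yx; split=> //; apply: dG Gx _ _; first exact: coneM.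
  exact: vleM.
Qed.

Lemma dotpD x y z : dotp (x + y) z = dotp x z + dotp y z.
Proof. by rewrite -big_split; apply: eq_bigr => i _; rewrite mxE mulrDl. Qed.

Lemma dotpZ (a : R) x y : dotp (a *: x) y = a * dotp x y.
Proof. by rewrite /dotp mulr_sumr; apply: eq_bigr => i _; rewrite mxE mulrA. Qed.

Lemma dotpC x y : dotp x y = dotp y x.
Proof. by apply: eq_bigr => i _; rewrite mulrC. Qed.

Lemma dotp_le x y z : cone z -> vle x y -> dotp x z <= dotp y z.
Proof. by move=> /coneP z0 xy; apply: ler_sum => i _; rewrite ler_wpM2r. Qed.

Lemma dotp_ge0 x y : cone x -> cone y -> 0 <= dotp x y.
Proof. by move=> /coneP x0 /coneP y0; apply: sumr_ge0 => i _; rewrite mulr_ge0. Qed.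

Lemma dotp_trmx (M : 'M[R]_d) x y : dotp (M^T *m x) y = dotp x (M *m y).
Proof.
have E a b : dotp a b = (a^T *m b) 0 0.
  by rewrite mxE; apply: eq_bigr => i _; rewrite mxE.
by rewrite !E trmx_mul trmxK mulmxA.
Qed.

Lemma mono_convex_halfspace x (c : R) : cone x ->
  mono_convex [set y | cone y /\ dotp y x <= c].
Proof.
move=> cx; split.
- apply/convex_setE => y z a b [cy hy] [cz hz] a0 b0 ab; split.
    by apply: coneD; apply: coneZ.
  rewrite dotpD !dotpZ -[c]mul1r -ab mulrDl.
  by apply: lerD; apply: ler_wpM2l.
- by move=> y [].
- move=> y z [cy hy] cz zy; split=> //; apply: le_trans hy; exact: dotp_le.
Qed.

Lemma scale_set_comp (a b : R) G : scale_set a (scale_set b G) = scale_set (a * b) G.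
Proof.
apply/seteqP; split=> [_ [_ [x Gx <-] <-]|_ [x Gx <-]].
  by exists x; rewrite ?scalerA.
by exists (b *: x); rewrite ?scalerA //; exists x.
Qed.

Lemma scale_set1 G : scale_set 1 G = G.
Proof.
apply/seteqP; split=> [_ [x Gx <-]|x Gx]; first by rewrite scale1r.
by exists x; rewrite ?scale1r.
Qed.

Lemma scale_setK (c : R) G : c != 0 -> scale_set c^-1 (scale_set c G) = G.
Proof. by move=> c0; rewrite scale_set_comp mulVf // scale_set1. Qed.

Lemma scale_setP (c : R) G x : 0 < c -> scale_set c G x <-> G (c^-1 *: x).
Proof.
move=> c0; split=> [[y Gy <-]|Gx]; first by rewrite scalerA mulVf ?gt_eqF // scale1r.
by exists (c^-1 *: x) => //; rewrite scalerA divff ?gt_eqF // scale1r.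
Qed.

Lemma mono_convex_scale (c : R) G : 0 < c -> mono_convex G ->
  mono_convex (scale_set c G).
Proof.
move=> c0 [/convex_setE cG Gc dG]; split.
- apply/convex_setE => x y a b [x' Gx <-] [y' Gy <-] a0 b0 ab.
  exists (a *: x' + b *: y'); first exact: cG.
  by rewrite scalerDr !scalerA ![c * _]mulrC.
- by move=> _ [x /Gc cx <-]; apply: coneZ => //; exact: ltW.
- move=> _ y [x Gx <-] cy yx; apply/scale_setP => //; apply: dG Gx _ _.
    by apply: coneZ => //; rewrite invr_ge0 ltW.
  have := @vleZ c^-1 _ _ _ yx; rewrite invr_ge0 (ltW c0) => /(_ isT).
  by rewrite scalerA mulVf ?gt_eqF // scale1r.
Qed.

Lemma scale_mono_hull (c : R) K : 0 < c -> K `<=` cone ->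
  scale_set c (mono_hull K) = mono_hull (scale_set c K).
Proof.
(* One inclusion suffices: the other is the same one for [c^-1] and the set [scale_set c K]. *)
suff main (e : R) H : 0 < e -> H `<=` cone ->
    mono_hull (scale_set e H) `<=` scale_set e (mono_hull H).
  move=> c0 Kc; apply/seteqP; split; last exact: main.
  move=> _ [x hx <-]; have ci : 0 < c^-1 by rewrite invr_gt0.
  have Kc' : scale_set c K `<=` cone.
    by move=> _ [z Kz <-]; apply: coneZ; [exact: ltW | exact: Kc].
  have := @main c^-1 (scale_set c K) ci Kc'.
  rewrite scale_setK ?gt_eqF // => /(_ _ hx) /(scale_setP _ _ ci).
  by rewrite invrK.
move=> e0 Hc; apply: mono_hull_min.
  by apply: mono_convex_scale => //; exact: mono_hull_mono_convex.
by move=> _ [x Hx <-]; exists x => //; apply: sub_mono_hull.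
Qed.

Lemma closed_approx G y : closed G ->
  (forall e, 0 < e -> exists2 z, G z & `|y - z| <= e) -> G y.
Proof.
move=> clG h; apply: clG => B /nbhs_ballP[e /= e0 eB].
have e20 : 0 < e / 2 by rewrite divr_gt0.
have [z Gz hz] := h _ e20; exists z; split=> //; apply: eB.
rewrite -ball_normE /=; apply: le_lt_trans hz _.
by rewrite ltr_pdivrMr // ltr_pMr // ltr1n.
Qed.

End MonoConvex.

(** * Compactness and vertices of monotone polytopes *)

Section Polytope.
Context {R : realType} {d : nat}.
Implicit Types (x y z p q : 'cV[R]_d) (G H K : set 'cV[R]_d) (s : seq 'cV[R]_d).

Lemma continuous_mx (T : topologicalType) m n (f : T -> 'M[R]_(m, n)) :
  (forall i j, continuous (fun t => f t i j)) -> continuous f.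
Proof.
move=> h t A /= [P hP PA].
apply: filterS; first by move=> u; apply: PA.
by apply: filter_forall => i; apply: filter_forall => j; apply: h (hP i j).
Qed.

(** For [p] in the cone and a nonempty monotone convex [H], this is the monotone hull of [p] and [H]
    with a single segment parameter, so that finite hulls can be built point by point. *)
Definition join_point p H : set 'cV[R]_d :=
  [set y | cone y /\ exists t q, [/\ 0 <= t <= 1, H q & vle y (t *: p + (1 - t) *: q)]].

Lemma mono_convex_cone_comb H q z (a b : R) : mono_convex H -> H q -> H z ->
  0 <= a -> 0 <= b -> exists2 h, H h & a *: q + b *: z = (a + b) *: h.
Proof.
move=> mH Hq Hz a0 b0; have [/eqP|ab] := eqVneq (a + b) 0.
  rewrite paddr_eq0 // => /andP[/eqP-> /eqP->].
  by exists q; rewrite // addr0 !scale0r addr0.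
exists ((a + b)^-1 *: (a *: q + b *: z)); last by rewrite scalerA divff // scale1r.
rewrite scalerDr !scalerA; apply: mono_convex_comb => //.
- by rewrite mulr_ge0 // invr_ge0 addr_ge0.
- by rewrite mulr_ge0 // invr_ge0 addr_ge0.
- by rewrite -mulrDr mulVf.
Qed.

Lemma join_point_mono_convex p H : cone p -> mono_convex H ->
  mono_convex (join_point p H).
Proof.
move=> cp mH; split.
- apply/convex_setE => x y a b [cx [t [q [/andP[t0 t1] Hq xq]]]].
  move=> [cy [u [z [/andP[u0 u1] Hz yz]]]] a0 b0 ab.
  split; first by apply: coneD; apply: coneZ.
  have a' : 0 <= a * (1 - t) by rewrite mulr_ge0 // subr_ge0.
  have b' : 0 <= b * (1 - u) by rewrite mulr_ge0 // subr_ge0.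
  have T1 : 1 - (a * t + b * u) = a * (1 - t) + b * (1 - u).
    by rewrite -[X in X - _]ab; ring.
  have [h Hh Eh] := mono_convex_cone_comb mH Hq Hz a' b'.
  exists (a * t + b * u), h; split=> //.
    by rewrite addr_ge0 ?mulr_ge0 //= -subr_ge0 T1 addr_ge0.
  rewrite T1 -Eh; apply: vle_trans (vleD (vleZ a0 xq) (vleZ b0 yz)) _ => i.
  by rewrite !mxE le_eqVlt; apply/orP; left; apply/eqP; ring.
- by move=> x [].
- move=> x y [cx [t [q [t01 Hq xq]]]] cy yx; split=> //.
  by exists t, q; split=> //; apply: vle_trans yx xq.
Qed.

(** Adjoining 0 to [s] keeps the second hull nonempty when [s] is empty. *)
Lemma mono_hull_cons_join p s : [set` p :: s] `<=` cone ->
  mono_hull [set` p :: s] `<=` join_point p (mono_hull [set` 0 :: s]).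
Proof.
move=> sc; have cp : cone p by apply: sc; rewrite /= inE eqxx.
have s0c : [set` 0 :: s] `<=` cone.
  move=> x /=; rewrite inE => /predU1P[->|xs]; first exact: cone0.
  by apply: sc; rewrite /= inE xs orbT.
apply: mono_hull_min.
  by apply: join_point_mono_convex => //; exact: mono_hull_mono_convex.
move=> x /= xs; split; first exact: sc.
move: xs; rewrite inE => /predU1P[->|xs].
  exists 1, 0; rewrite ler01 lexx; split=> //.
    by apply: sub_mono_hull => //=; rewrite inE eqxx.
  by rewrite subrr !scale1r scaler0 addr0.
exists 0, x; rewrite ler01 lexx; split=> //.
  by apply: sub_mono_hull => //=; rewrite inE xs orbT.
by rewrite subr0 scale0r scale1r add0r.
Qed.

Lemma mono_hull_cons0 s : [set` s] `<=` cone -> s != [::] ->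
  mono_hull [set` 0 :: s] = mono_hull [set` s].
Proof.
move=> sc sne; apply: mono_hull_eq => x /=.
  rewrite inE => /predU1P[->|xs]; last by apply: sub_mono_hull.
  case: s sc sne => // y s sc _.
  have [_ _ h] := @mono_hull_mono_convex R d [set` y :: s].
  have ys : [set` y :: s] y by rewrite /= inE eqxx.
  by apply: (h y); [exact: sub_mono_hull | exact: cone0 | exact: sc].
move=> xs; apply: sub_mono_hull; last by rewrite /= inE xs orbT.
by move=> y /=; rewrite inE => /predU1P[->|]; [exact: cone0 | exact: sc].
Qed.

(** A point of the cone lies below [z] exactly when it is [z] with each coordinate multiplied by a
    factor in [[0, 1]]. The join is thus a continuous image of [[0, 1]], [H] and a cube. *)
Lemma compact_join p H : cone p -> H `<=` cone -> compact H ->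
  compact (join_point p H).
Proof.
move=> cp Hc cH.
pose f (z : R * 'cV[R]_d * 'rV[R]_d) : 'cV[R]_d :=
  \col_i (z.2 0 i * (z.1.1 * p i 0 + (1 - z.1.1) * z.1.2 i 0)).
pose D : set (R * 'cV[R]_d * 'rV[R]_d) :=
  `[0, 1] `*` H `*` [set c : 'rV[R]_d | forall i, `[0, 1]%classic (c ord0 i)].
have -> : join_point p H = f @` D.
  apply/seteqP; split.
    move=> y [/coneP cy [t [q [t01 Hq yq]]]].
    (* Where the denominator vanishes, [y i 0] vanishes too, and the default value 0 of the quotient
       is a valid factor. *)
    exists (t, q, \row_i (y i 0 / (t *: p + (1 - t) *: q) i 0)).
      split; first by split=> //=; rewrite in_itv.
      move=> i /=; rewrite mxE in_itv /=.
      have qi := yq i; have zi : 0 <= (t *: p + (1 - t) *: q) i 0.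
        exact: le_trans (cy i) qi.
      rewrite divr_ge0 //=; have [->|z0] := eqVneq ((t *: p + (1 - t) *: q) i 0) 0.
        by rewrite invr0 mulr0 ler01.
      by rewrite ler_pdivrMr ?mul1r // lt_neqAle eq_sym z0.
    apply/colP => i; rewrite mxE /= mxE.
    have qi := yq i; rewrite -[t * _ + _](_ : (t *: p + (1 - t) *: q) i 0 = _); last first.
      by rewrite !mxE.
    have [z0|z0] := eqVneq ((t *: p + (1 - t) *: q) i 0) 0; last by rewrite divfK.
    by rewrite z0 mulr0; apply/eqP; rewrite eq_le cy -[leRHS]z0 qi.
  move=> _ [[[t q] c] [[/= t01 Hq] hc] <-].
  have t01' : 0 <= t <= 1 by move: t01; rewrite in_itv.
  have zi i : 0 <= t * p i 0 + (1 - t) * q i 0.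
    have /coneP pi := cp; have /coneP qi := Hc _ Hq; case/andP: t01' => t0 t1.
    by rewrite addr_ge0 // mulr_ge0 // subr_ge0.
  split.
    apply/coneP => i; rewrite mxE /= mulr_ge0 //.
    by have := hc i; rewrite /= in_itv => /andP[].
  exists t, q; split=> // i; rewrite !mxE /=.
  by rewrite ler_piMl //; have := hc i; rewrite /= in_itv => /andP[].
apply: continuous_compact.
  apply: continuous_subspaceT; apply: continuous_mx => i j.
  rewrite (_ : (fun u => _) = fun z : R * 'cV[R]_d * 'rV[R]_d =>
    z.2 0 i * (z.1.1 * p i 0 + (1 - z.1.1) * z.1.2 i 0)); last first.
    by apply/funext => z; rewrite mxE.
  have c1 : continuous (fun z : R * 'cV[R]_d * 'rV[R]_d => z.1.1).
    by move=> z; apply: continuous_comp; exact: cvg_fst.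
  have c2 : continuous (fun z : R * 'cV[R]_d * 'rV[R]_d => z.1.2 i 0).
    move=> z; apply: (@continuous_comp _ _ _ (fun z : R * 'cV[R]_d * 'rV[R]_d => z.1.2)
      (fun M : 'cV[R]_d => M i 0)); last exact: coord_continuous.
    by apply: continuous_comp; [exact: cvg_fst | exact: cvg_snd].
  have c3 : continuous (fun z : R * 'cV[R]_d * 'rV[R]_d => z.2 0 i).
    move=> z; apply: (@continuous_comp _ _ _ (fun z : R * 'cV[R]_d * 'rV[R]_d => z.2)
      (fun M : 'rV[R]_d => M 0 i)); last exact: coord_continuous.
    exact: cvg_snd.
  move=> z; apply: cvgM; first exact: c3.
  apply: cvgD; first by apply: cvgM; [exact: c1 | exact: cvg_cst].
  apply: cvgM; last exact: c2.
  by apply: cvgB; [exact: cvg_cst | exact: c1].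
apply: compact_setX; first by apply: compact_setX => //; exact: segment_compact.
exact: (@rV_compact R d (fun=> `[0, 1]%classic) (fun=> @segment_compact R 0 1)).
Qed.

Lemma mono_hull_zero : mono_hull [set` [:: 0 : 'cV[R]_d]] = [set 0].
Proof.
apply/seteqP; split=> [|_ ->]; last first.
  apply: sub_mono_hull; last by rewrite /= inE.
  by move=> x /=; rewrite inE => /eqP->; exact: cone0.
move=> y [cy [x hx yx]].
have x0 : x = 0.
  have : [set 0] x; last by [].
  apply: (smallest_sub _ _ hx) => [|z /=]; last by rewrite inE => /eqP.
  by apply/convex_setE => u z a b -> -> _ _ _; rewrite !scaler0 addr0.
by apply: vle_antisym cy; rewrite -x0.
Qed.

Lemma compact_mono_hull_cons0 s : [set` s] `<=` cone ->
  compact (mono_hull [set` 0 :: s]).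
Proof.
elim: s => [|p s IH] sc; first by rewrite mono_hull_zero; exact: compact_set1.
have cp : cone p by apply: sc; rewrite /= inE eqxx.
have sc' : [set` s] `<=` cone by move=> x xs; apply: sc; rewrite /= inE xs orbT.
rewrite (_ : mono_hull _ = join_point p (mono_hull [set` 0 :: s])).
  by apply: compact_join (IH sc') => // y [].
rewrite mono_hull_cons0 //; apply/seteqP; split; first exact: mono_hull_cons_join.
move=> y [cy [t [q [/andP[t0 t1] Hq yq]]]].
have mH := @mono_hull_mono_convex R d [set` p :: s].
have [_ _ dH] := mH; apply: (dH _ _ _ cy yq).
have Hp : mono_hull [set` p :: s] p by apply: sub_mono_hull => //=; rewrite inE eqxx.
apply: mono_convex_comb => //; [|by rewrite subr_ge0|by rewrite addrC subrK].
move: q Hq {yq}; apply: mono_hull_min => // x /=; rewrite inE => /predU1P[->|xs].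
  by apply: (dH _ _ Hp cone0).
by apply: sub_mono_hull => //=; rewrite inE xs orbT.
Qed.

Lemma compact_mono_hull s : [set` s] `<=` cone -> compact (mono_hull [set` s]).
Proof.
case: s => [_|p s sc]; last by rewrite -mono_hull_cons0 //; exact: compact_mono_hull_cons0.
rewrite (_ : mono_hull _ = set0); first exact: compact0.
apply/seteqP; split=> // y [_ [x hx _]].
by apply: (smallest_sub _ _ hx) => // a b l; rewrite inE.
Qed.

(** The point [p] is extreme for both convexity and order: [p <= t p + (1 - t) q] with [q] in [H]
    and [t < 1] would give [p <= q], hence [p] in [H]. *)
Lemma mono_convex_remove G p H : mono_convex G -> mono_convex H -> ~ H p ->
  G `<=` join_point p H -> mono_convex [set y | G y /\ y <> p].
Proof.
move=> mG mH nHp GJ; have [cG Gc dG] := mG; have [_ _ dH] := mH.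
have cone_p y : G y -> vle p y -> y = p -> cone p by move=> Gy _ <-; exact: Gc.
have key t q : H q -> cone p -> t <= 1 -> vle p (t *: p + (1 - t) *: q) -> t = 1.
  move=> Hq cp t1 h; apply/eqP; rewrite eq_le t1 /= leNgt; apply/negP => t1'.
  apply: nHp; apply: dH Hq cp _ => i; have := h i; rewrite !mxE => hi.
  by rewrite -(ler_pM2l (_ : 0 < 1 - t)) ?subr_gt0 //; lra.
split.
- apply/convex_setE => x y a b [Gx xp] [Gy yp] a0 b0 ab.
  split; first by apply: mono_convex_comb => //; rewrite ab.
  move=> Ep; have cp : cone p by rewrite -Ep; apply: coneD; apply: coneZ => //; exact: Gc.
  have [_ [t [q [/andP[t0 t1] Hq xq]]]] := GJ _ Gx.
  have [_ [u [z [/andP[u0 u1] Hz yz]]]] := GJ _ Gy.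
  have a' : 0 <= a * (1 - t) by rewrite mulr_ge0 // subr_ge0.
  have b' : 0 <= b * (1 - u) by rewrite mulr_ge0 // subr_ge0.
  have T1 : 1 - (a * t + b * u) = a * (1 - t) + b * (1 - u).
    by rewrite -[X in X - _]ab; ring.
  have [h Hh Eh] := mono_convex_cone_comb mH Hq Hz a' b'.
  have T : a * t + b * u = 1.
    apply: (key _ h) => //; first by rewrite -subr_ge0 T1 addr_ge0.
    rewrite T1 -Eh -[X in vle X _]Ep.
    apply: vle_trans (vleD (vleZ a0 xq) (vleZ b0 yz)) _ => i.
    by rewrite !mxE le_eqVlt; apply/orP; left; apply/eqP; ring.
  have /eqP : a * (1 - t) + b * (1 - u) = 0 by rewrite -T1 T subrr.
  rewrite paddr_eq0 // !mulf_eq0 !subr_eq0 => /andP[/orP at1 /orP bu1].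
  have [a00|an0] := eqVneq a 0.
    have b1 : b = 1 by move: ab; rewrite a00 add0r.
    by apply: yp; rewrite -Ep a00 b1 scale0r add0r scale1r.
  have [b00|bn0] := eqVneq b 0.
    have a1 : a = 1 by move: ab; rewrite b00 addr0.
    by apply: xp; rewrite -Ep b00 a1 scale0r addr0 scale1r.
  have t1' : 1 = t by case: at1 => /eqP // e; rewrite e eqxx in an0.
  have u1' : 1 = u by case: bu1 => /eqP // e; rewrite e eqxx in bn0.
  (* Both parameters being 1, [x <= p] and [y <= p]; with [p = a x + b y] and [a > 0] this forces
     [x = p]. *)
  apply: xp; apply/colP => i.
  have := xq i; have := yz i; have := congr1 (fun M : 'cV_d => M i 0) Ep.
  rewrite -t1' -u1' subrr !scale0r !addr0 !scale1r !mxE => e hy hx.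
  have ap : 0 < a by rewrite lt_neqAle eq_sym an0.
  apply/eqP; rewrite eq_le hx /= -(ler_pM2l ap).
  have Epi : a * p i 0 + b * p i 0 = p i 0 by rewrite -mulrDl ab mul1r.
  by have := ler_wpM2l b0 hy; lra.
- by move=> x [/Gc].
- move=> x y [Gx xp] cy yx; split; first exact: dG Gx cy yx.
  move=> yp; apply: xp; rewrite yp in cy yx *.
  have [_ [t [q [/andP[t0 t1] Hq xq]]]] := GJ _ Gx.
  have t1' : t = 1 by apply: (key _ q) => //; exact: vle_trans yx xq.
  apply: vle_antisym => //; move: xq.
  by rewrite t1' subrr scale0r addr0 scale1r.
Qed.

(** A generating list of least size works. None of its points [p] lies in the hull of the others, so
    [G] without [p] is still monotone convex, and a generating set that misses [p] would generate
    only a part of it. *)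
Lemma vertex_set_exists G s : [set` s] `<=` cone -> G = mono_hull [set` s] ->
  (exists2 x, G x & x != 0) ->
  exists s', is_vertex_set G [set` s'].
Proof.
elim: {s}(size s).+1 {-2}s (ltnSn (size s)) => // n IH s sn sc EG [x0 Gx0 x00].
have [[s1 [s1s s1c E1]]|nmin] := pselect (exists s1, [/\ (size s1 < size s)%N,
    [set` s1] `<=` cone & G = mono_hull [set` s1]]).
  by apply: (IH s1) => //; [exact: leq_trans s1s _ | exists x0].
exists s; split=> //.
move=> W finW Wc EW p /= ps; apply: contrapT => nWp.
have Es : [set` s] = [set` p :: rem p s].
  by apply/seteqP; split=> x /=; rewrite (perm_mem (perm_to_rem ps)).
have ssub : [set` rem p s] `<=` cone by move=> x /mem_rem; exact: sc.
have cp : cone p by exact: sc.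
have Gp : G p by rewrite EG; exact: sub_mono_hull.
have mG : mono_convex G by rewrite EG; exact: mono_hull_mono_convex.
have nHp : ~ mono_hull [set` 0 :: rem p s] p.
  (* The adjoined 0 matters only if no other point remains; then [p] is nonzero because [G] has a
     nonzero point. *)
  have [r0|rn0] := eqVneq (rem p s) [::].
    rewrite r0 mono_hull_zero /= => p0; move: x00 Gx0.
    by rewrite EG Es r0 p0 mono_hull_zero /= => /eqP.
  rewrite mono_hull_cons0 // => hp; apply: nmin; exists (rem p s); split=> //.
    rewrite size_rem // prednK //; last by case: (s) ps.
  rewrite EG Es; apply: mono_hull_eq => x /=.
    by rewrite inE => /predU1P[->|xs] //; exact: sub_mono_hull.
  move=> xs; apply: sub_mono_hull; last by rewrite /= inE xs orbT.
  by rewrite -Es.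
have mG' : mono_convex [set y | G y /\ y <> p].
  apply: (mono_convex_remove mG (mono_hull_mono_convex _) nHp).
  by rewrite EG Es; apply: mono_hull_cons_join; rewrite -Es.
have : [set y | G y /\ y <> p] p; last by case.
have GW : G `<=` [set y | G y /\ y <> p]; last exact: GW.
rewrite {1}EW; apply: mono_hull_min => // y Wy; split.
  by rewrite EW; exact: sub_mono_hull.
by move=> yp; apply: nWp; rewrite -yp.
Qed.
End Polytope.

(** * Invariant bodies *)

Section Words.
Context {m : nat}.

Fixpoint words n : seq (seq 'I_m) :=
  if n is k.+1 then [::] :: [seq j :: u | j <- enum 'I_m, u <- words k] else [::].

Lemma mem_words n u : (u \in words n) = (size u < n)%N.
Proof.
elim: n u => [|n IH] [|j u] //=; rewrite inE /=.
apply/allpairsP/idP => [[[i s] /= [_ us [_ ->]]]|us]; first by rewrite ltnS -IH.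
by exists (j, u); rewrite /= mem_enum IH.
Qed.
End Words.

Section Reach.
Context {R : realType} {d m : nat}.
Variable A : 'I_m -> 'M[R]_d.

(** The coordinates made positive by some product span a coordinate subspace invariant under the
    family; it is nonzero since [x] is, hence it is the whole space. *)
Lemma irreducible_reach (x : 'cV[R]_d) : family_nonneg A ->
  positively_irreducible A -> cone x -> x != 0 ->
  forall i, exists u, 0 < (word_prod A u *m x) i 0.
Proof.
move=> A0 irr cx x0.
pose S := [set i : 'I_d | `[< exists u, 0 < (word_prod A u *m x) i 0 >]]%SET.
have x_ge0 u : mx_nonneg (word_prod A u *m x).
  by apply: mx_nonnegM; [exact: word_prod_nonneg | exact/cone_nonneg].
have inS i : i \in S <-> exists u, 0 < (word_prod A u *m x) i 0.
  by rewrite inE; split=> [/asboolP|?] //; apply/asboolP.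
suff ST : S = finset.setTfor 'I_d.
  by move=> i; apply/inS; rewrite ST finset.in_setT.
apply: contrapT => SnT; apply: irr; exists S; split.
- apply: contra_neq x0 => S0; apply/colP => i; rewrite mxE; apply/eqP.
  rewrite eq_le; have /coneP -> := cx; rewrite andbT leNgt; apply/negP => xi.
  have : i \in S by apply/inS; exists [::]; rewrite word_prod_nil mul1mx.
  by rewrite S0 finset.in_set0.
- by rewrite finset.properT; apply/eqP.
- move=> j _ [y hy <-] i niS; rewrite mxE big1 // => k _.
  have [kS|/hy->] := boolP (k \in S); last by rewrite mulr0.
  have [u uk] := (inS k).1 kS.
  have [->|Ajk] := eqVneq (A j i k) 0; first by rewrite mul0r.
  case/negP: niS; apply/inS; exists (j :: u).
  rewrite word_prod_cons -mulmxA mxE (bigD1 k) //= ltr_pwDl //.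
    by rewrite mulr_gt0 // lt_neqAle eq_sym Ajk A0.
  by apply: sumr_ge0 => l _; rewrite mulr_ge0 // ?A0 ?x_ge0.
Qed.
End Reach.

Section BodyGeneral.
Context {R : realType} {d : nat}.
Implicit Types (x y z e : 'cV[R]_d) (G H : set 'cV[R]_d).

Definition absv e : 'cV[R]_d := \col_i `|e i 0|.

Lemma absv_cone e : cone (absv e).
Proof. by apply/coneP => i; rewrite mxE. Qed.

Lemma vle_absv e : vle e (absv e).
Proof. by move=> i; rewrite mxE ler_norm. Qed.

Lemma norm_absv e : `|absv e| <= `|e|.
Proof.
apply: mx_norm_le => // i j; rewrite mxE normr_id.
exact: mx_norm_entry.
Qed.

Lemma mono_body_convex G : mono_body G -> mono_convex G.
Proof.
move=> [_ cG _ Gc dG]; split=> // x y Gx cy yx; exact: (dG x).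
Qed.

Lemma mono_body_of_box G (kp : R) : compact G -> mono_convex G -> 0 < kp ->
  (forall y, cone y -> `|y| <= kp -> G y) -> mono_body G.
Proof.
move=> cpG [cG Gc dG] kp0 box; split=> //.
have k2 : 0 < kp / 2 by rewrite divr_gt0.
(* The ball of radius [kp / 2] about this vector has all entries between 0 and [kp]. *)
exists (const_mx (kp / 2)); apply/nbhs_ballP; exists (kp / 2) => //= y.
rewrite -ball_normE /= => hy.
have hyi i : `|kp / 2 - y i 0| < kp / 2.
  have := mx_norm_entry (const_mx (kp / 2) - y) i 0.
  by rewrite !mxE => /le_lt_trans; apply.
apply: box.
  by apply/coneP => i; have := hyi i; rewrite ltr_norml => /andP[_]; lra.
apply: mx_norm_le => [|i j]; first exact: ltW.
rewrite ord1; have := hyi i; rewrite ltr_norml => /andP[h1 h2].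
by rewrite ler_norml; apply/andP; split; lra.
Qed.

Lemma mono_body_pos G : mono_body G -> exists2 z, G z & forall i, 0 < z i 0.
Proof.
move=> [_ _ [z /nbhs_ballP[e /= e0 eG]] Gc _].
exists z; first by apply: eG; exact: ballxx.
have e2 : 0 < e / 2 by rewrite divr_gt0.
have : G (z - const_mx (e / 2)).
  apply: eG; rewrite -ball_normE /= opprB addrC subrK.
  apply: (@le_lt_trans _ _ (e / 2)).
    by apply: mx_norm_le => [|i j]; rewrite ?mxE ?ger0_norm // ltW.
  by rewrite ltr_pdivrMr // ltr_pMr // ltr1n.
move=> /Gc/coneP h i; have := h i; rewrite !mxE; lra.
Qed.

Lemma compact_norm_bound G : compact G ->
  exists2 M : R, 0 < M & forall x, G x -> `|x| <= M.
Proof.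
move=> /compact_bounded[M [_ hM]]; exists (`|M| + 1); first by rewrite ltr_wpDl.
move=> x Gx; apply: hM => //; apply: le_lt_trans (ler_norm M) _.
by rewrite ltrDl.
Qed.

Lemma mono_convex_avg G (x_ : 'I_d -> 'cV[R]_d) : (0 < d)%N -> mono_convex G ->
  (forall i, G (x_ i)) -> G (\sum_i d%:R^-1 *: x_ i).
Proof.
move=> d0 mG Gx; have i0 : 'I_d := Ordinal d0.
have d0' : 0 < d%:R :> R by rewrite ltr0n.
suff [h Gh ->] : exists2 h, G h &
    \sum_(i < d) d%:R^-1 *: x_ i = (\sum_(i < d) d%:R^-1) *: h.
  rewrite sumr_const card_ord -[d%:R^-1 *+ d]mulr_natl divff ?gt_eqF //.
  by rewrite scale1r.
rewrite -!(big_enum _ _ predT) /=; elim: (enum _) => [|i s [h Gh Eh]].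
  by exists (x_ i0); rewrite // !big_nil scale0r.
rewrite !big_cons Eh; apply: mono_convex_cone_comb => //.
by apply: sumr_ge0 => *; rewrite invr_ge0 ltW.
Qed.

Lemma pos_lower_bound z : (forall i, 0 < z i 0) ->
  exists2 kp : R, 0 < kp & forall i, kp <= z i 0.
Proof.
move=> z0; exists (\big[Num.min/1]_i z i 0); last by move=> i; exact: bigmin_le.
by elim/big_ind: _ => // a b a0 b0; rewrite lt_min a0 b0.
Qed.

End BodyGeneral.

(** The invariance equation with factor 1. Leaving [jsr] out lets the normalized family and the
    substitute for the zero family be treated alike. *)
Definition fixed_body (R : realType) d m (B : 'I_m -> 'M[R]_d) (G : set 'cV[R]_d) :=
  mono_body G /\ G = mono_hull (\bigcup_j [set B j *m x | x in G]).

Definition fixed_norm (R : realType) d m (B : 'I_m -> 'M[R]_d) (f : 'cV[R]_d -> R) :=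
  mono_norm f /\
  forall x, cone x -> is_max [set f (B j *m x) | j in setT] (f x).

Section Core.
Context {R : realType} {d m : nat}.
Variables (B : 'I_m -> 'M[R]_d) (w : seq 'I_m) (v : 'cV[R]_d) (r : 'rV[R]_d).
Hypothesis coreB : core B w v r.
Local Notation W := (word_prod B).

Let B0 := core_nonneg coreB.

Lemma core_W0 u : mx_nonneg (W u). Proof. exact: word_prod_nonneg. Qed.

Lemma core_vcone : cone v. Proof. by apply/cone_nonneg; case: coreB. Qed.

Lemma core_vneq0 : v != 0.
Proof.
apply: contra_eq_neq (core_rv coreB) => ->; rewrite mulmx0; apply/eqP.
by move=> /matrixP/(_ 0 0); rewrite !mxE => /eqP; rewrite eq_sym oner_eq0.
Qed.

Lemma core_dpos : (0 < d)%N.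
Proof.
rewrite lt0n; apply/eqP => d0; have := core_vneq0; move: v; rewrite d0 => v'.
by rewrite (flatmx0 v') eqxx.
Qed.

Lemma core_Wv u : cone (W u *m v).
Proof. by apply: coneM; [exact: core_W0 | exact: core_vcone]. Qed.

Lemma core_powv k : W (word_pow w k) *m v = v.
Proof.
elim: k => [|k IH]; first by rewrite word_prod_nil mul1mx.
by rewrite word_powS word_prod_cat -mulmxA IH (core_wv coreB).
Qed.

Definition orbit_seq n := [seq W u *m v | u <- words n].

Lemma orbit_seq_cone n : [set` orbit_seq n] `<=` cone.
Proof. by move=> _ /= /mapP[u _ ->]; exact: core_Wv. Qed.

Definition orbit_hull n := mono_hull [set` orbit_seq n].

Lemma orbit_hull_mono_convex n : mono_convex (orbit_hull n).
Proof. exact: mono_hull_mono_convex. Qed.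

Lemma orbit_hull_mem n u : (size u < n)%N -> orbit_hull n (W u *m v).
Proof.
move=> un; apply: sub_mono_hull; first exact: orbit_seq_cone.
by apply/mapP; exists u; rewrite ?mem_words.
Qed.

(** By irreducibility, each coordinate of [v] becomes positive under some word; the average of these
    orbit points is a positive vector of the hull, and a box lies below it. *)
Lemma orbit_hull_box : exists2 kp, 0 < kp & exists N, forall n, (N <= n)%N ->
  forall y, cone y -> `|y| <= kp -> orbit_hull n y.
Proof.
have reach := irreducible_reach B0 (core_irr coreB) core_vcone core_vneq0.
pose u_ i := sval (cid (reach i)).
have hu i : 0 < (W (u_ i) *m v) i 0 by rewrite /u_; case: cid.
pose z := \sum_i d%:R^-1 *: (W (u_ i) *m v).
have d0' : 0 < d%:R^-1 :> R by rewrite invr_gt0 ltr0n core_dpos.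
have z0 i : 0 < z i 0.
  rewrite summxE (bigD1 i) //= ltr_pwDl //; first by rewrite mxE mulr_gt0.
  apply: sumr_ge0 => k _; rewrite mxE mulr_ge0 ?(ltW d0') //.
  by have /coneP := core_Wv (u_ k).
have [kp kp0 hkp] := pos_lower_bound z0.
exists kp => //; exists (\max_i size (u_ i))%N.+1 => n Nn y cy yk.
have [_ _ dQ] := orbit_hull_mono_convex n.
apply: (dQ z) => //.
  apply: mono_convex_avg; [exact: core_dpos|exact: orbit_hull_mono_convex|].
  move=> i; apply: orbit_hull_mem; apply: leq_trans Nn; rewrite ltnS.
  exact: (@leq_bigmax _ (fun i => size (u_ i)) i).
move=> i; apply: le_trans (hkp i); apply: le_trans (ler_norm _) _.
exact: le_trans (mx_norm_entry _ _ _) yk.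
Qed.

Lemma core_approx_apply (M e : R) : 0 < M -> 0 < e ->
  exists N, forall u, (N <= size u)%N ->
   (forall x : 'cV[R]_d, `|x| <= M -> `|W u *m x| <= e) \/
   exists a b K, u = a ++ word_pow w K.+1 ++ b /\
     forall x : 'cV[R]_d, `|x| <= M ->
       `|W u *m x - (r *m (W b *m x)) 0 0 *: (W a *m v)| <= e.
Proof.
move=> M0 e0; pose D := d%:R * M; have D0 : 0 < D by rewrite mulr_gt0 // ltr0n core_dpos.
have eD : 0 < e / D by rewrite divr_gt0.
have bnd (X : 'M[R]_d) (x : 'cV[R]_d) : `|X| <= e / D -> `|x| <= M -> `|X *m x| <= e.
  move=> hX hx; apply: le_trans (mx_normM _ _) _.
  rewrite -[leRHS](divfK (lt0r_neq0 D0)) /D [leRHS]mulrCA ler_wpM2l // ler_pM //.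
have [N hN] := approx_word coreB eD; exists N => u /hN[h|[a [b [K [Eu h]]]]].
  by left=> x; exact: bnd.
right; exists a, b, K; split=> // x xM.
have := bnd _ x h xM; rewrite mulmxBl; congr (`|_ - _| <= _).
rewrite -!mulmxA [X in v *m X]mx11_scalar mul_mx_scalar.
by rewrite -scalemxAr.
Qed.

(** Induction on the length of [u]: a long word has [W u *m v] small or close to [weight b] times
    the point of the shorter word [a]. If [b] is a power of [w], the two points coincide; otherwise
    the gap [tau] of the weight leaves room for the error. *)
Lemma orbit_hull_all : exists N, forall n, (N <= n)%N ->
  forall u, orbit_hull n (W u *m v).
Proof.
have [kp kp0 [N0 hbox]] := orbit_hull_box.
have [tau tau0 htau] := weight_gap coreB.
(* The bound [kp] puts small points into the box; the bound [tau * kp] lets a point of the box with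
   coefficient [tau] absorb the error. *)
have e0 : 0 < Num.min kp (tau * kp) by rewrite lt_min kp0 mulr_gt0.
have v0 : 0 < `|v| by rewrite normr_gt0 core_vneq0.
have [N1 hN1] := core_approx_apply v0 e0.
exists (maxn N0 N1) => n; rewrite geq_max => /andP[n0 n1] u.
move: {2}(size u).+1 (ltnSn (size u)) => k; elim: k u => // k IH u uk.
have [un|nu] := ltnP (size u) n; first exact: orbit_hull_mem.
have [h|[a [b [K [Eu h]]]]] := hN1 u (leq_trans n1 nu).
  apply: hbox => //; first exact: core_Wv.
  by apply: le_trans (h v _) _ => //; rewrite ge_min lexx.
have au : (size a < size u)%N.
  rewrite Eu 2!size_cat size_word_pow mulSn -{1}[size a]addn0 ltn_add2l -addnA.
  by apply: ltn_addr; have := core_wne coreB; case: (w).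
have Ha : orbit_hull n (W a *m v) by apply: IH; exact: leq_trans au _.
have [[j bj]|wb] := htau b.
  by rewrite Eu 2!word_prod_cat -!mulmxA bj !core_powv.
have [_ _ dQ] := orbit_hull_mono_convex n.
set x := W u *m v; set q := W a *m v in Ha h; set t := weight B v r b in wb.
have te : `|x - t *: q| <= tau * kp.
  have := h v (lexx _); rewrite /t /weight mulmxA => hh; apply: le_trans hh _.
  by rewrite ge_min lexx orbT.
have t0 : 0 <= t := weight_ge0 coreB b.
apply: (dQ ((1 - tau) *: q + tau *: (tau^-1 *: absv (x - t *: q)))).
- apply: mono_convex_comb => //; [exact: orbit_hull_mono_convex| | lra | exact: ltW | lra].
  apply: hbox => //; first by apply: coneZ; [rewrite invr_ge0 ltW | exact: absv_cone].
  rewrite normrZ gtr0_norm ?invr_gt0 // ler_pdivrMl //.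
  exact: le_trans (norm_absv _) te.
- exact: core_Wv.
- rewrite scalerA divff ?gt_eqF // scale1r => i.
  have := vle_absv (x - t *: q) i; have /coneP qi := core_Wv a.
  have := ler_wpM2r (qi i) wb; rewrite -/q !mxE; lra.
Qed.

End Core.

Section CoreBodies.
Context {R : realType} {d m : nat}.
Variables (B : 'I_m -> 'M[R]_d) (w : seq 'I_m) (v : 'cV[R]_d) (r : 'rV[R]_d).
Hypothesis coreB : core B w v r.
Local Notation W := (word_prod B).

Let B0 := core_nonneg coreB.

Lemma core_r_ge0 (x : 'cV[R]_d) : cone x -> 0 <= (r *m x) 0 0.
Proof.
move=> cx; apply: (mx_nonnegM (core_r0 coreB)); exact/cone_nonneg.
Qed.

Lemma core_r_pos (x : 'cV[R]_d) : (forall i, 0 < x i 0) -> 0 < (r *m x) 0 0.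
Proof.
move=> x0; have cx : cone x by apply/coneP => i; exact: ltW.
rewrite lt_neqAle core_r_ge0 // andbT eq_sym; apply/eqP => rx.
have : r != 0.
  apply: contra_eq_neq (core_rv coreB) => ->; rewrite mul0mx; apply/eqP.
  by move=> /matrixP/(_ 0 0); rewrite !mxE => /eqP; rewrite eq_sym oner_eq0.
move/negP; apply; apply/eqP/rowP => i; rewrite mxE.
have r0 := core_r0 coreB.
move: rx; rewrite mxE => /eqP; rewrite psumr_eq0 => [|k _]; last first.
  by rewrite mulr_ge0 // ltW.
move=> /allP/(_ i); rewrite mem_index_enum => /(_ isT).
by rewrite mulf_eq0 (gt_eqF (x0 i)) orbF => /eqP.
Qed.

Lemma vrE (x : 'cV[R]_d) : v *m r *m x = (r *m x) 0 0 *: v.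
Proof. by rewrite -mulmxA [X in v *m X]mx11_scalar mul_mx_scalar. Qed.

Lemma core_lim_apply (x : 'cV[R]_d) e : 0 < e ->
  exists k, `|W (word_pow w k) *m x - (r *m x) 0 0 *: v| <= e.
Proof.
move=> e0; have [N /(_ N (leqnn N))] := core_lim_mul coreB (1%:M : 'M[R]_d) x e0.
by rewrite !mul1mx mulmxA vrE => h; exists N; rewrite word_prod_pow.
Qed.

Lemma orbit_hull_fixed : exists n, fixed_body B (orbit_hull B v n) /\
  forall u, orbit_hull B v n (W u *m v).
Proof.
have [kp kp0 [N0 hbox]] := orbit_hull_box coreB.
have [N1 hall] := orbit_hull_all coreB.
exists (maxn N0 N1); set n := maxn _ _.
have n0 : (N0 <= n)%N by rewrite leq_maxl.
have orb := hall n (leq_maxr _ _); split=> //.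
have mQ := orbit_hull_mono_convex B v n.
have Qc : [set` orbit_seq B v n] `<=` cone by exact: (orbit_seq_cone coreB).
have BQ j x : orbit_hull B v n x -> orbit_hull B v n (B j *m x).
  have mP := mono_convex_preim (B0 j) mQ.
  move=> hx; suff [] : [set x | cone x /\ orbit_hull B v n (B j *m x)] x by [].
  move: x hx; apply: mono_hull_min => // x /= /mapP[u _ ->]; split.
    exact: (core_Wv coreB).
  by rewrite mulmxA -word_prod_cons.
split.
  apply: mono_body_of_box kp0 (hbox n n0) => //.
  exact: compact_mono_hull.
apply/seteqP; split; last first.
  by apply: mono_hull_min => // _ [j _ [x Qx <-]]; exact: BQ.
apply: mono_hull_min; first exact: mono_hull_mono_convex.
have cU : \bigcup_j [set B j *m x | x in orbit_hull B v n] `<=` cone.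
  by move=> _ [j _ [x [cx _] <-]]; exact: coneM.
have key j u : mono_hull (\bigcup_j [set B j *m x | x in orbit_hull B v n])
    (W (j :: u) *m v).
  apply: sub_mono_hull => //; exists j => //; exists (W u *m v); first exact: orb.
  by rewrite mulmxA -word_prod_cons.
move=> _ /= /mapP[[_ ->|j u _ ->]]; last exact: key.
(* The empty word contributes [v] itself, which is an image of an orbit point because [v = W w *m v]
   and [w] is nonempty. *)
have := core_wv coreB; have := core_wne coreB; case: (w) => // j u _ Ev.
by rewrite word_prod_nil mul1mx -[X in mono_hull _ X]Ev; exact: key.
Qed.

Lemma fixed_body_invar G u x : fixed_body B G -> G x -> G (W u *m x).
Proof.
move=> [bG EG]; have mG := mono_body_convex bG; have [_ Gc _] := mG.
elim: u => [|j u IH] Gx; first by rewrite word_prod_nil mul1mx.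
rewrite word_prod_cons -mulmxA EG; apply: sub_mono_hull.
  by move=> _ [i _ [y Gy <-]]; apply: coneM => //; exact: Gc.
by exists j => //; exists (W u *m x) => //; exact: IH.
Qed.

(** Unfolding the invariance equation [n] times shows that [G] is generated by its images under
    products of exactly [n] matrices. *)
Lemma fixed_body_iter G H n : fixed_body B G -> mono_convex H ->
  (forall u x, size u = n -> G x -> H (W u *m x)) -> G `<=` H.
Proof.
move=> fG mH; have [bG EG] := fG; have [_ Gc _] := mono_body_convex bG.
elim: n => [|n IH] h.
  by move=> x Gx; have := h [::] x erefl Gx; rewrite word_prod_nil mul1mx.
apply: IH => u x us Gx.
have mP := mono_convex_preim (core_W0 coreB u) mH.
rewrite EG in Gx.
suff [] : [set x | cone x /\ H (W u *m x)] x by [].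
move: x Gx; apply: mono_hull_min => // _ [j _ [x Gx <-]]; split.
  by apply: coneM => //; exact: Gc.
have := h (u ++ [:: j]) x; rewrite size_cat us addn1 word_prod_cat.
by rewrite word_prod_cons word_prod_nil mulmx1 mulmxA; apply.
Qed.

Lemma fixed_body_limit G x : fixed_body B G -> G x -> G ((r *m x) 0 0 *: v).
Proof.
move=> fG Gx; apply: closed_approx => [|e e0].
  by apply: compact_closed; [exact: norm_hausdorff | case: fG => -[]].
have [k hk] := core_lim_apply x e0.
by exists (W (word_pow w k) *m x); [exact: fixed_body_invar | rewrite distrC].
Qed.

Lemma fixed_body_unique G n : fixed_body B G ->
  fixed_body B (orbit_hull B v n) -> (forall u, orbit_hull B v n (W u *m v)) ->
  exists2 c : R, 0 < c & G = scale_set c (orbit_hull B v n).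
Proof.
move=> fG fQ orb; have [bG EG] := fG; have mG := mono_body_convex bG.
have [cG Gc dG] := mG; have [bQ EQ] := fQ; have mQ := mono_body_convex bQ.
have clG : closed G by apply: compact_closed; [exact: norm_hausdorff | case: bG].
have clQ : closed (orbit_hull B v n).
  by apply: compact_closed; [exact: norm_hausdorff | case: bQ].
have [M M0 hM] : exists2 M : R, 0 < M & forall x, G x -> `|x| <= M.
  by apply: compact_norm_bound; case: bG.
have v0 : 0 < `|v| by rewrite normr_gt0 (core_vneq0 coreB).
have [z Gz z0] := mono_body_pos bG.
(* The scaling factor is the largest multiple of [v] in [G]; by [fixed_body_limit], it bounds the
   coefficient [r x] of every point [x] of [G]. *)
pose S := [set s : R | 0 <= s /\ G (s *: v)].
have SP x : G x -> S ((r *m x) 0 0).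
  by move=> Gx; split; [apply: core_r_ge0; exact: Gc | exact: fixed_body_limit].
have supS : has_sup S.
  split; first by exists ((r *m z) 0 0); exact: SP.
  exists (M / `|v|) => s [s0 /hM]; rewrite normrZ ger0_norm // => h.
  by rewrite ler_pdivlMr.
pose c := sup S.
have cub s : S s -> s <= c by move=> Ss; apply: ub_le_sup => //; exact: supS.2.
have c0 : 0 < c by apply: lt_le_trans (cub _ (SP _ Gz)); exact: core_r_pos.
have Gcv : G (c *: v).
  apply: closed_approx => // e e0.
  have [s Ss hs] := sup_adherent (divr_gt0 e0 v0) supS.
  exists (s *: v); first by case: Ss.
  rewrite -scalerBl normrZ ger0_norm ?subr_ge0 ?cub //.
  by rewrite -ler_pdivlMr // lerBlDr -lerBlDl ltW.
exists c => //; apply/seteqP; split; last first.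
  rewrite scale_mono_hull //; last exact: (orbit_seq_cone coreB).
  apply: mono_hull_min => // _ [_ /= /mapP[u _ ->] <-].
  by rewrite scalemxAr; exact: fixed_body_invar.
have step eta : 0 < eta -> G `<=` scale_set (c + eta) (orbit_hull B v n).
  move=> eta0; have ce0 : 0 < c + eta by rewrite addr_gt0.
  have mS := mono_convex_scale ce0 mQ; have [_ _ dS] := mS.
  (* The box may come from a hull of larger index, but that hull lies in this one, which already
     contains the whole orbit. *)
  have [kp kp0 hbox] : exists2 kp, 0 < kp &
      forall y, cone y -> `|y| <= kp -> orbit_hull B v n y.
    have [kp kp0 [N0 hb]] := orbit_hull_box coreB.
    exists kp => // y cy yk; have := hb (maxn N0 n) (leq_maxl _ _) y cy yk.
    apply: mono_hull_min => // _ /= /mapP[u _ ->]; exact: orb.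
  have [N hN] := core_approx_apply coreB M0 (mulr_gt0 eta0 kp0).
  have small (y : 'cV[R]_d) : cone y -> `|y| <= eta * kp ->
      orbit_hull B v n (eta^-1 *: y).
    move=> cy hy; apply: hbox; first by apply: coneZ => //; rewrite invr_ge0 ltW.
    by rewrite normrZ gtr0_norm ?invr_gt0 // ler_pdivrMl.
  have comb (q y : 'cV[R]_d) : orbit_hull B v n q -> cone y -> `|y| <= eta * kp ->
      scale_set (c + eta) (orbit_hull B v n) (c *: q + y).
    move=> Qq cy /(small _ cy) Qy.
    have [h Qh Eh] := mono_convex_cone_comb mQ Qq Qy (ltW c0) (ltW eta0).
    exists h => //; rewrite -Eh scalerA divff ?gt_eqF // scale1r //.
  apply: (fixed_body_iter (n := N) fG) => // u x uN Gx.
  have cWx : cone (W u *m x) by apply: coneM; [exact: (core_W0 coreB) | exact: Gc].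
  have uN' : (N <= size u)%N by rewrite uN.
  have [h|[a [b [K [Eu h]]]]] := hN u uN'.
    have vleDr (q y : 'cV[R]_d) : cone q -> vle y (c *: q + y).
      by move=> /coneP q0 i; rewrite !mxE lerDr mulr_ge0 // ltW.
    have := comb _ _ (orb [::]) cWx (h _ (hM _ Gx)) => /dS; apply=> //.
    by apply: vleDr; exact: (core_Wv coreB).
  have := h _ (hM _ Gx); set t := _ 0 0; set q := W a *m v => te.
  (* [t] is the limit coefficient of [W b *m x], which is a point of [G]. *)
  have tc : t <= c by apply: cub; apply: SP; exact: fixed_body_invar.
  have := comb q (absv (W u *m x - t *: q)) (orb a) (absv_cone _)
    (le_trans (norm_absv _) te).
  move=> /dS; apply=> // i; have := vle_absv (W u *m x - t *: q) i.
  have /coneP qi := core_Wv coreB a; have := ler_wpM2r (qi i) tc.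
  by rewrite -/q !mxE; lra.
move=> x Gx; apply/scale_setP => //; apply: closed_approx => // e e0.
pose D := `|x| + 1; have D0 : 0 < D by rewrite ltr_wpDl.
(* Replacing [c + eta] by [c] moves the point by [eta |x| / (c (c + eta))], which is at most
   [eta D / c^2 = e]. *)
have [eta eta0 Eeta] : exists2 eta, 0 < eta & eta * D = e * (c * c).
  exists (e * (c * c) / D); last by rewrite divfK ?gt_eqF.
  by rewrite divr_gt0 // !mulr_gt0.
have ce0 : 0 < c + eta by rewrite addr_gt0.
exists ((c + eta)^-1 *: x); first by apply/scale_setP => //; exact: step.
rewrite -scalerBl normrZ.
have -> : c^-1 - (c + eta)^-1 = eta / (c * (c + eta)).
  by field; rewrite (gt_eqF c0) gt_eqF.
rewrite ger0_norm; last by rewrite divr_ge0 ?(ltW eta0) // mulr_ge0 // ltW.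
rewrite mulrAC ler_pdivrMr ?mulr_gt0 //.
apply: (@le_trans _ _ (e * (c * c))).
  by rewrite -Eeta ler_wpM2l ?(ltW eta0) // /D lerDl.
by rewrite ler_wpM2l ?(ltW e0) // ler_wpM2l ?(ltW c0) // lerDl ltW.
Qed.

End CoreBodies.

(** * Barabanov norms and duality *)

Section MonoNorm.
Context {R : realType} {d : nat}.
Variable f : 'cV[R]_d -> R.
Hypothesis nf : mono_norm f.

Lemma mono_norm_ge0 x : cone x -> 0 <= f x.
Proof.
case: nf => -[hom _ _] mono cx; have <- : f 0 = 0.
  by rewrite -(scale0r (0 : 'cV[R]_d)) hom ?mul0r //; exact: cone0.
by apply: mono => //; exact: vle_refl.
Qed.

(** Since [y <= t z + e 1] entrywise, monotonicity and subadditivity do the work of continuity. *)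
Lemma mono_norm_perturb (y z : 'cV[R]_d) (t e : R) : cone y -> cone z -> 0 <= t ->
  `|y - t *: z| <= e -> f y <= t * f z + e * f (const_mx 1).
Proof.
case: (nf) => -[hom sub _] mono cy cz t0 he.
have e0 : 0 <= e := le_trans (normr_ge0 _) he.
have c1 : cone (const_mx 1 : 'cV[R]_d) by apply/coneP => i; rewrite mxE.
rewrite -!hom //; apply: le_trans (sub _ _ _ _); [|exact: coneZ|exact: coneZ].
apply: mono => // i; have := mx_norm_entry (y - t *: z) i 0.
move=> /le_trans/(_ he)/(le_trans (ler_norm _)).
by rewrite !mxE mulr1; lra.
Qed.
End MonoNorm.

Section NormUnique.
Context {R : realType} {d m : nat}.
Variables (B : 'I_m -> 'M[R]_d) (w : seq 'I_m) (v : 'cV[R]_d) (r : 'rV[R]_d).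
Hypothesis coreB : core B w v r.
Local Notation W := (word_prod B).

Lemma fixed_norm_word f u x : fixed_norm B f -> cone x -> f (W u *m x) <= f x.
Proof.
move=> [nf hf] cx; elim: u => [|j u IH]; first by rewrite word_prod_nil mul1mx.
have cu : cone (W u *m x) by apply: coneM; [exact: (core_W0 coreB) |].
apply: le_trans IH; rewrite word_prod_cons -mulmxA.
by have [_ ub] := hf _ cu; apply: ub; exists j.
Qed.

Lemma fixed_norm_attained f n x : fixed_norm B f -> cone x ->
  exists u, size u = n /\ f (W u *m x) = f x.
Proof.
move=> [nf hf]; elim: n x => [|n IH] x cx.
  by exists [::]; rewrite word_prod_nil mul1mx.
have [[j _ Ej] _] := hf x cx.
have [|u [us Eu]] := IH (B j *m x); first by apply: coneM => //; exact: (core_nonneg coreB).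
exists (u ++ [:: j]); rewrite size_cat us addn1; split=> //.
by rewrite word_prod_cat word_prod_cons word_prod_nil mulmx1 -mulmxA Eu.
Qed.

(** A long word [u] with [f (W u *m x) = f x] gives, up to small errors, [f x <= t f v] with
    [t = r (W b) x]. Moreover [t v] is a limit of images of [x], so [t g v <= g x]; multiplying the
    two bounds yields the claim. *)
Lemma fixed_norm_le f g x : fixed_norm B f -> fixed_norm B g -> cone x ->
  f x * g v <= g x * f v.
Proof.
move=> hf hg cx; have [nf _] := hf; have [ng _] := hg.
have cv := core_vcone coreB; pose one : 'cV[R]_d := const_mx 1.
have c1 : cone one by apply/coneP => i; rewrite mxE.
have f0 y : cone y -> 0 <= f y by exact: mono_norm_ge0.
have g0 y : cone y -> 0 <= g y by exact: mono_norm_ge0.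
apply/ler_addgt0Pr => e e0.
pose D := f one * g v + g one * f v + 1.
have D1 : 0 <= f one * g v by rewrite mulr_ge0 ?f0 ?g0.
have D2 : 0 <= g one * f v by rewrite mulr_ge0 ?f0 ?g0.
have D0 : 0 < D by rewrite /D; lra.
have [eta eta0 Eeta] : exists2 eta, 0 < eta & eta * D = e.
  by exists (e / D); [rewrite divr_gt0 | rewrite divfK ?gt_eqF].
have M0 : 0 < `|x| + 1 by rewrite ltr_wpDl.
have xM : `|x| <= `|x| + 1 by rewrite lerDl.
have [N hN] := core_approx_apply coreB M0 eta0.
have [u [uN Eu]] := fixed_norm_attained N hf cx.
have uN' : (N <= size u)%N by rewrite uN.
have cW s : cone (W s *m x) by apply: coneM; [exact: (core_W0 coreB) |].
have gx : 0 <= g x * f v by rewrite mulr_ge0 ?f0 ?g0.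
(* If the product is small, [f x] itself is at most [eta * f one]. *)
have [h|[a [b [K [_ h]]]]] := hN u uN'.
  have h1 : f x <= eta * f one.
    rewrite -Eu; have := @mono_norm_perturb _ _ f nf (W u *m x) 0 0 eta (cW u) cone0.
    by rewrite scale0r subr0 mul0r add0r; apply=> //; exact: h.
  have := ler_wpM2r (g0 v cv) h1.
  have := mulr_ge0 (ltW eta0) D2; move: Eeta; rewrite /D; lra.
have := h x xM; set t := _ 0 0 => te.
have t0 : 0 <= t by apply: (core_r_ge0 coreB).
have fx : f x <= t * f v + eta * f one.
  rewrite -Eu.
  apply: le_trans (mono_norm_perturb nf (cW u) (core_Wv coreB a) t0 te) _.
  by rewrite lerD2r ler_wpM2l // fixed_norm_word.
have [k hk] := core_lim_apply coreB (W b *m x) eta0.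
have tg : t * g v <= g x + eta * g one.
  have [[hom _ _] _] := ng; rewrite -hom //.
  have := @mono_norm_perturb _ _ g ng (t *: v) (W (word_pow w k) *m (W b *m x)) 1 eta.
  rewrite scale1r mul1r distrC => /(_ (coneZ t0 cv)) hh.
  apply: le_trans (hh _ ler01 hk) _; first by rewrite mulmxA -word_prod_cat.
  by rewrite lerD2r mulmxA -word_prod_cat fixed_norm_word.
have := ler_wpM2r (g0 v cv) fx; have := ler_wpM2r (f0 v cv) tg.
move: Eeta; rewrite /D; nra.
Qed.

Lemma fixed_norm_unique f g : fixed_norm B f -> fixed_norm B g ->
  exists2 c : R, 0 < c & forall x, cone x -> g x = c * f x.
Proof.
move=> hf hg; have cv := core_vcone coreB; have v0 := core_vneq0 coreB.
have fv : 0 < f v by case: hf => -[[_ _ pos] _] _; exact: pos.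
have gv : 0 < g v by case: hg => -[[_ _ pos] _] _; exact: pos.
exists (g v / f v) => [|x cx]; first exact: divr_gt0.
have E : f x * g v = g x * f v.
  by apply/eqP; rewrite eq_le fixed_norm_le //= fixed_norm_le.
by rewrite mulrAC [g v * _]mulrC E mulfK // gt_eqF.
Qed.
End NormUnique.

Section Support.
Context {R : realType} {d m : nat}.
Variable B : 'I_m -> 'M[R]_d.
Implicit Types (s : seq 'cV[R]_d) (x y : 'cV[R]_d).

(** For [s] in the cone, the default 0 is harmless on the cone, where all [dotp y x] are
    non-negative. *)
Definition support_fun s x : R := \big[Num.max/0]_(y <- s) dotp y x.

Lemma support_fun_max s x : [set` s] `<=` cone -> s != [::] -> cone x ->
  is_max [set dotp y x | y in [set` s]] (support_fun s x).
Proof.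
move=> sc sne cx; split; last first.
  by move=> _ [y /= ys <-]; rewrite /support_fun; apply: le_bigmax_seq ys _.
have : exists2 y, y \in s & dotp y x = support_fun s x; last by move=> [y ys E]; exists y.
elim: s sc sne => // y s IH sc _; rewrite /support_fun big_cons.
have y0 : 0 <= dotp y x by apply: dotp_ge0 => //; apply: sc; rewrite /= inE eqxx.
have [s0|sne] := eqVneq s [::].
  by exists y; rewrite ?inE ?eqxx // s0 big_nil max_l.
have [|z zs Ez] := IH _ sne; first by move=> z zs; apply: sc; rewrite /= inE zs orbT.
rewrite -[\big[_/_]_(_ <- _) _]/(support_fun s x) -Ez.
have [h|h] := leP (dotp y x) (dotp z x); first by exists z; rewrite // inE zs orbT.
by exists y; rewrite // inE eqxx.
Qed.

(** The maximum over [s] is also the maximum over its hull, since half-spaces cut monotone convex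
    sets from the cone. The identity [(B_j^T y, x) = (y, B_j x)] turns invariance of the hull under
    the transposes into the norm equation; a positive vector of the hull makes the function positive
    off zero. *)
Lemma support_fun_fixed s (j0 : 'I_m) : family_nonneg B -> [set` s] `<=` cone ->
  fixed_body (dual_family B) (mono_hull [set` s]) ->
  (forall x, cone x -> is_max [set dotp y x | y in [set` s]] (support_fun s x)) /\
  fixed_norm B (support_fun s).
Proof.
move=> B0 sc; set G := mono_hull _ => -[bG EG]; set f := support_fun s.
have [z Gz z0] := mono_body_pos bG.
have sne : s != [::].
  apply/eqP => s0; have [_ [x hx _]] := Gz; rewrite s0 in hx.
  by apply: (smallest_sub _ _ hx) => // a b l; rewrite inE.
have fmax x : cone x -> is_max [set dotp y x | y in [set` s]] (f x).
  by move=> cx; exact: support_fun_max.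
split=> //.
have fatt x : cone x -> exists2 y, y \in s & f x = dotp y x.
  by move=> cx; have [[y ys <-] _] := fmax x cx; exists y.
have fub x y : cone x -> G y -> dotp y x <= f x.
  move=> cx Gy; have mH := mono_convex_halfspace (f x) cx.
  suff [] : [set y | cone y /\ dotp y x <= f x] y by [].
  move: y Gy; apply: mono_hull_min => // y ys; split; first exact: sc.
  by have [_ ub] := fmax x cx; apply: ub; exists y.
have fubs x y : cone x -> y \in s -> dotp y x <= f x.
  by move=> cx ys; apply: fub => //; exact: sub_mono_hull.
split; first split; first split.
- move=> c x c0 cx; have cZ := coneZ c0 cx.
  have dZ y : dotp y (c *: x) = c * dotp y x by rewrite dotpC dotpZ dotpC.
  apply/eqP; rewrite eq_le; apply/andP; split.
    by have [y ys ->] := fatt _ cZ; rewrite dZ ler_wpM2l // fubs.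
  by have [y ys ->] := fatt _ cx; rewrite -dZ fubs.
- move=> x y cx cy; have [z1 zs ->] := fatt _ (coneD cx cy).
  by rewrite dotpC dotpD lerD // dotpC fubs.
- move=> x cx x0; apply: lt_le_trans (fub x z cx Gz).
  have /coneP xi := cx; rewrite lt_neqAle eq_sym dotp_ge0 ?andbT //; last first.
    by apply/coneP => i; exact: ltW.
  apply: contra_neq x0; move/eqP; rewrite psumr_eq0; last first.
    by move=> i _; rewrite mulr_ge0 // ltW.
  move=> /allP h; apply/colP => i; rewrite mxE; apply/eqP.
  by have := h i; rewrite mem_index_enum mulf_eq0 (gt_eqF (z0 i)) => /(_ isT).
- move=> x y cy yx; have cx : cone x by exact: vle_trans cy yx.
  have [u us ->] := fatt _ cy; apply: le_trans (fubs x u cx us).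
  by rewrite ![dotp u _]dotpC; apply: dotp_le => //; exact: sc.
move=> x cx; have cB j : cone (B j *m x) by exact: coneM.
have fB j : f (B j *m x) <= f x.
  have [y ys ->] := fatt _ (cB j); rewrite -dotp_trmx; apply: fub => //.
  rewrite EG; apply: sub_mono_hull.
    move=> _ [i _ [u [cu _] <-]]; apply: coneM => // k l; rewrite mxE; exact: B0.
  by exists j => //; exists y => //; exact: sub_mono_hull.
split; last by move=> _ [j _ <-].
pose j := [arg max_(j > j0) f (B j *m x)]%O; exists j => //.
have jmax i : f (B i *m x) <= f (B j *m x).
  by rewrite /j; case: arg_maxP => // k _ hk; exact: hk.
apply/eqP; rewrite eq_le fB /=.
have [y ys Ey] := fatt _ cx; rewrite Ey.
have Gy : G y by exact: sub_mono_hull.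
suff [] : [set y | cone y /\ dotp y x <= f (B j *m x)] y by [].
(* Every point of [G] is generated by points [B_i^T u] with [u] in [G], so it suffices to bound
   [(u, B_i x)] by the largest [f (B_j x)]. *)
move: y Gy {ys Ey}; rewrite EG; apply: mono_hull_min.
  exact: mono_convex_halfspace.
move=> _ [i _ [u Gu <-]]; split.
  case: Gu => cu _; apply: coneM => // k l; rewrite mxE; exact: B0.
by rewrite dotp_trmx; apply: le_trans (jmax i); exact: fub.
Qed.
End Support.

Section Dual.
Context {R : realType} {d m : nat}.

Lemma mx_norm_trmx p q (M : 'M[R]_(p, q)) : `|M^T| = `|M|.
Proof.
have le p' q' (X : 'M[R]_(p', q')) : `|X^T| <= `|X|.
  by apply: mx_norm_le => // i j; rewrite mxE mx_norm_entry.
by apply/eqP; rewrite eq_le le /= -[X in `|X| <= _]trmxK le.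
Qed.

Lemma word_prod_dual (A : 'I_m -> 'M[R]_d) u :
  word_prod (dual_family A) u = (word_prod A (rev u))^T.
Proof.
elim: u => [|j u IH]; first by rewrite !word_prod_nil trmx1.
rewrite rev_cons -cats1 word_prod_cat trmx_mul word_prod_cons IH.
by rewrite word_prod_cons word_prod_nil mulmx1.
Qed.

Lemma rev_word_pow (u : seq 'I_m) k : rev (word_pow u k) = word_pow (rev u) k.
Proof.
elim: k => [|k IH] //.
by rewrite word_powS rev_cat IH word_powSr.
Qed.

Lemma dominated_rev (u s : seq 'I_m) : dominated u s -> dominated (rev u) (rev s).
Proof.
move=> [i [k ->]]; exists (size u - i)%N, k; rewrite rev_word_pow; congr word_pow.
by rewrite rev_rot /rotr size_rev.
Qed.

Lemma dual_nonneg (A : 'I_m -> 'M[R]_d) : 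
  family_nonneg A -> family_nonneg (dual_family A).
Proof. by move=> A0 j k l; rewrite mxE; exact: A0. Qed.

(** Basis vectors indexed by [S] show that invariance under the transposes means [A j i k = 0] for
    [i] in [S] and [k] outside; this is invariance of the complementary subspace under the
    family. *)
Lemma dual_irreducible (A : 'I_m -> 'M[R]_d) :
  positively_irreducible A -> positively_irreducible (dual_family A).
Proof.
move=> irr [S [S0 SnT hS]]; apply: irr; exists (finset.setC S); split.
- by apply: contraTneq SnT => E; rewrite -[S]finset.setCK E finset.setC0 finset.properT eqxx.
- rewrite finset.properT; apply: contra_neq S0 => E.
  by rewrite -[S]finset.setCK E finset.setCT.
- move=> j _ [x hx <-] i; rewrite finset.in_setC negbK => iS; rewrite mxE big1 // => k _.
  have [kS|kS] := boolP (k \in S).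
    by rewrite (hx k) ?mulr0 // finset.in_setC negbK.
  have : coord_subspace S ((A j)^T *m (delta_mx i 0 : 'cV[R]_d)).
    apply: hS; exists (delta_mx i 0) => // l lS; rewrite mxE eqxx andbT.
    by case: eqP lS => // ->; rewrite iS.
  by move/(_ k kS); rewrite -colE !mxE => ->; rewrite mul0r.
Qed.

(** Transposition reverses words and exchanges the two eigenvectors. Norms and determinants are
    preserved, and reversal maps dominated words to dominated words. *)
Lemma core_dual (B : 'I_m -> 'M[R]_d) w v r :
  core B w v r -> core (dual_family B) (rev w) r^T v^T.
Proof.
move=> cB; have Ew : word_prod (dual_family B) (rev w) = (word_prod B w)^T.
  by rewrite word_prod_dual revK.
have Ewk k : word_prod (dual_family B) (rev w) ^+ k = (word_prod B w ^+ k)^T.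
  by rewrite -!word_prod_pow -rev_word_pow word_prod_dual revK.
split.
- exact: dual_nonneg (core_nonneg cB).
- exact: dual_irreducible (core_irr cB).
- move=> rw; apply: (core_wne cB); rewrite -[w]revK rw //.
- have [C hC] := core_bdd cB; exists C => u.
  by rewrite word_prod_dual mx_norm_trmx.
- have [sg sg0 hsg] := core_gap cB; exists sg => // s sne nd.
  rewrite word_prod_dual -[1%:M]trmx1 -linearB /= det_tr; apply: hsg.
    by move=> rs; apply: sne; rewrite -[s]revK rs.
  by move=> /dominated_rev; rewrite revK.
- by move=> i j; rewrite mxE; exact: (core_r0 cB).
- by move=> i j; rewrite mxE; exact: (core_v0 cB).
- by rewrite -trmx_mul (core_rv cB) trmx1.
- by rewrite Ew -trmx_mul (core_rw cB).
- by rewrite Ew -trmx_mul (core_wv cB).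
- move=> e e0; have [N hN] := core_lim cB e0; exists N => k /hN.
  by rewrite Ewk -trmx_mul -linearB /= mx_norm_trmx.
Qed.
End Dual.

(** * Normalization by the dominant product *)

Section SpectralRadius.
Context {R : realType} {d : nat}.
Implicit Types (M : 'M[R]_d) (z : R[i]) (rs : seq R[i]).

Definition spectrum_of M rs := [/\ size rs = d,
  char_poly (complexify M) = \prod_(z <- rs) ('X - z%:P) &
  forall k, \tr (complexify M ^+ k) = \sum_(z <- rs) z ^+ k].

Lemma complexify_scale (c : R) M : complexify (c *: M) = c%:C%C *: complexify M.
Proof. by apply/matrixP => i j; rewrite !mxE rmorphM. Qed.

Lemma spectrum_ofE M : exists2 rs, spectrum_of M rs &
  forall c : R, spectrum_of (c *: M) [seq c%:C%C * z | z <- rs].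
Proof.
have [rs sz hrs] := spectrum_exists (complexify M); exists rs.
  have [h1 h2] := hrs 1; split=> // [|k].
    by rewrite -[complexify M]scale1r h1; apply: eq_bigr => z _; rewrite mul1r.
  by rewrite -[complexify M]scale1r h2; apply: eq_bigr => z _; rewrite mul1r.
move=> c; have [h1 h2] := hrs c%:C%C; split; first by rewrite size_map.
  by rewrite complexify_scale big_map h1.
by move=> k; rewrite complexify_scale big_map h2.
Qed.

Lemma spectrum_mem M rs z : spectrum_of M rs ->
  (z \in rs) = eigenvalue (complexify M) z.
Proof. by move=> [_ h _]; rewrite eigenvalue_root_char h root_prod_XsubC. Qed.

Lemma eigenvalue_le_radius M z : eigenvalue (complexify M) z ->
  `|z| <= (spectral_radius M)%:C%C.
Proof.
move=> ez; have [rs hrs _] := spectrum_ofE M.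
rewrite -norm_complexE lecR; apply: ub_le_sup; last by exists z.
exists (\sum_(y <- rs) complex.Re `|y|) => _ [y ey <-].
have yrs : y \in rs by rewrite (spectrum_mem _ hrs).
have Re0 (x : R[i]) : 0 <= complex.Re `|x| by rewrite -lecR norm_complexE normr_ge0.
by rewrite (big_rem y) //= lerDl; apply: sumr_ge0 => x _; exact: Re0.
Qed.

Lemma spectral_radius_eq M z : eigenvalue (complexify M) z ->
  (forall y, eigenvalue (complexify M) y -> `|y| <= `|z|) ->
  (spectral_radius M)%:C%C = `|z|.
Proof.
move=> ez hz; apply/eqP; rewrite eq_le eigenvalue_le_radius // andbT.
rewrite -norm_complexE lecR; apply: ge_sup; first by exists (complex.Re `|z|); exists z.
by move=> _ [y ey <-]; rewrite -lecR !norm_complexE hz.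
Qed.

Lemma spectral_radius_ge0 M : 0 <= spectral_radius M.
Proof.
have Re0 (x : R[i]) : 0 <= complex.Re `|x| by rewrite -lecR norm_complexE normr_ge0.
rewrite /spectral_radius; set E := [set _ | _ in _].
(* A set that is empty or unbounded above has the default supremum 0. *)
have [[[x [y ey Exy]] ub]|/sup_out -> //] := pselect (has_sup E).
by apply: le_trans (Re0 y) _; apply: ub_le_sup => //; exists y.
Qed.

Lemma trace_exp_le M (a : R) k :
  (forall z, eigenvalue (complexify M) z -> `|z| <= a%:C%C) ->
  \tr (M ^+ k) <= d%:R * a ^+ k.
Proof.
move=> ha; have [rs hrs _] := spectrum_ofE M; have [sz _ htr] := hrs.
apply: le_trans (ler_norm _) _; rewrite -lecR -norm_real_complex.
rewrite -[X in `|X|]trace_map_mx map_exprmx htr.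
apply: le_trans (ler_norm_sum _ _ _) _.
rewrite rmorphM rmorph_nat rmorphXn /=.
apply: le_trans (_ : \sum_(z <- rs) a%:C%C ^+ k <= _).
  rewrite big_seq [X in _ <= X]big_seq; apply: ler_sum => z zrs.
  have hz : `|z| <= a%:C%C by apply: ha; rewrite -(spectrum_mem _ hrs).
  by rewrite normrX lerXn2r ?nnegrE // (le_trans _ hz).
by rewrite big_const_seq count_predT iter_addr_0 sz mulr_natl.
Qed.

Lemma char_poly_horner (F : comNzRingType) n (M : 'M[F]_n) (a : F) :
  (char_poly M).[a] = \det (a%:M - M).
Proof.
rewrite -horner_evalE -det_map_mx; congr (\det _); apply/matrixP => i j.
by rewrite !mxE /= horner_evalE hornerD hornerN hornerMn hornerX hornerC.
Qed.

(** The determinant is the product of the [d] factors [1 - z], each of modulus at least [eps]. *)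
Lemma det_gap M rs (eps : R) : spectrum_of M rs -> 0 < eps -> eps < 1 ->
  (forall z, z \in rs -> `|z| <= (1 - eps)%:C%C) ->
  eps ^+ d <= `|\det (1%:M - M)|.
Proof.
move=> [sz hchar _] e0 e1 hrs; rewrite -lecR -norm_real_complex.
have -> : (\det (1%:M - M))%:C%C = (char_poly (complexify M)).[1].
  by rewrite char_poly_horner -det_map_mx map_mxB map_mx1.
rewrite hchar horner_prod rmorphXn /= -sz.
elim: rs hrs {sz hchar} => [|z rs IH] hrs; first by rewrite big_nil normr1 expr0.
rewrite big_cons normrM exprS ler_pM //.
- by rewrite ler0c ltW.
- by rewrite exprn_ge0 // ler0c ltW.
- rewrite hornerXsubC; have hz := hrs z (mem_head _ _).
  apply: le_trans (lerB_dist _ _); rewrite normr1.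
  by rewrite lerBrDl -lerBrDr (le_trans hz) // rmorphB rmorph1.
- by apply: IH => y yrs; apply: hrs; rewrite inE yrs orbT.
Qed.

End SpectralRadius.

Section PerronLeading.
Context {R : realType} {n : nat}.

(** Rescaling moves the spectrum into the closed unit disc, and non-negative traces make 1 an
    eigenvalue. Uniqueness and simplicity put all other eigenvalues strictly inside the disc, as
    [perron_projection] requires. *)
Lemma leading_projection (M : 'M[R]_n.+1) (lam : R[i]) (rho : R) :
  mx_nonneg M -> unique_simple_leading_eigenvalue M lam ->
  rho%:C%C = `|lam| -> 0 < rho ->
  exists (v : 'cV[R]_n.+1) (r : 'rV[R]_n.+1),
    [/\ mx_nonneg v, mx_nonneg r, r *m v = 1%:M,
      (rho^-1 *: M) *m v = v /\ r *m (rho^-1 *: M) = r &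
      forall e, 0 < e -> exists N, forall k, (N <= k)%N ->
        `|(rho^-1 *: M) ^+ k - v *m r| <= e].
Proof.
move=> M0 [elam lammax mup1 uniq] Erho rho0.
have [rs hrs hsc] := spectrum_ofE M; pose c := rho^-1.
have c0 : 0 < c by rewrite invr_gt0.
have [szc charc trc] := hsc c.
have cM0 : mx_nonneg (c *: M) by move=> i j; rewrite mxE mulr_ge0 // ltW.
have rho0C : rho%:C%C != 0 
  by rewrite -(rmorph0 (real_complex R)) (inj_eq (@complexI _)) gt_eqF.
have rhoC : 0 < rho%:C%C :> R[i] by rewrite ltcR.
have normc z : `|c%:C%C * z| = `|z| / rho%:C%C.
  by rewrite normrM norm_real_complex (gtr0_norm c0) mulrC /c rmorphV ?unitfE ?gt_eqF.
have le1 z : z \in rs -> `|c%:C%C * z| <= 1.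
  rewrite (spectrum_mem _ hrs) normc => /lammax; rewrite -Erho => h.
  by rewrite ler_pdivrMr ?mul1r.
have trpos k : 0 <= \sum_(z <- [seq c%:C%C * z | z <- rs]) z ^+ k.
  rewrite -trc -map_exprmx trace_map_mx ler0c; apply: sumr_ge0 => i _.
  suff : mx_nonneg ((c *: M) ^+ k) by apply.
  elim: k {i} => [|k IH] i j; first by rewrite expr0 mxE ler0n.
  by rewrite exprS; exact: (mx_nonnegM cM0 IH).
have lamrs : lam \in rs by rewrite (spectrum_mem _ hrs).
have one_in : 1 \in [seq c%:C%C * z | z <- rs].
  apply: (@nonneg_power_sums_root1 _ _ (c%:C%C * lam)) => //.
  - by move=> _ /mapP[z zrs ->]; exact: le1.
  - by apply/mapP; exists lam.
  - by rewrite normc -Erho divff.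
  - move=> b; exists (Num.bound `|complex.Re b|); apply/negP.
    have ReN k : complex.Re (k%:R : R[i]) = k%:R.
      by rewrite -(rmorph_nat (real_complex R)).
    rewrite lecE ReN => /andP[_]; apply/negP; rewrite -ltNge.
    by apply: le_lt_trans (ler_norm _) _; exact: archi_boundP.
have [z0 z0rs Ez0] : exists2 z0, z0 \in rs & z0 = rho%:C%C.
  move/mapP: one_in => [z zrs E]; exists z => //.
  have : rho%:C%C * 1 = rho%:C%C * (c%:C%C * z) by rewrite -E.
  rewrite mulr1 mulrA /c -rmorphM mulfV ?gt_eqF // rmorph1 mul1r => -> //.
(* [rho] is an eigenvalue of the largest modulus, so it is [lam] or its conjugate; as it is real,
   both cases give [lam = rho]. *)
have Elam : lam = rho%:C%C.
  have [->//|nl] := eqVneq lam rho%:C%C.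
  have [cl|ncl] := eqVneq (rho%:C%C) (conjc lam).
    by rewrite -[lam]conjcK -cl conjc_real.
  have := uniq z0; rewrite -(spectrum_mem _ hrs) => /(_ z0rs).
  rewrite Ez0 eq_sym nl ncl => /(_ isT isT); rewrite -Erho.
  by rewrite norm_real_complex gtr0_norm // ltxx.
have perm_rs := perm_to_rem lamrs.
have [_ hchar _] := hrs.
have nlam z : z \in rem lam rs -> z != lam.
  move=> zr; apply/eqP => E; move: mup1; rewrite hchar mu_prod_XsubC.
  rewrite (seq.permP perm_rs) /= eqxx add1n => -[] /eqP.
  rewrite -leqn0 leqNgt -has_count => /negP; apply.
  by apply/hasP; exists z => //=; rewrite E.
have lt1 z : z \in [seq c%:C%C * y | y <- rem lam rs] -> `|z| < 1.
  move=> /mapP[y yr ->]; rewrite normc ltr_pdivrMr // mul1r.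
  rewrite Erho; apply: uniq; first by rewrite -(spectrum_mem _ hrs) (mem_rem yr).
    exact: nlam.
  by rewrite Elam conjc_real -Elam nlam.
have clam : c%:C%C * lam = 1 by rewrite Elam -rmorphM mulVf ?gt_eqF.
have permc : perm_eq [seq c%:C%C * z | z <- rs]
    (1 :: [seq c%:C%C * z | z <- rem lam rs]).
  by rewrite -clam -map_cons perm_map.
apply: (perron_projection cM0 _ lt1).
  by rewrite charc (perm_big _ permc) big_cons.
by move=> k; rewrite trc (perm_big _ permc) big_cons expr1n.
Qed.
End PerronLeading.

Lemma word_prod_scale (R : realType) d m (A : 'I_m -> 'M[R]_d) (c : R) u :
  word_prod (fun j => c *: A j) u = c ^+ size u *: word_prod A u.
Proof.
elim: u => [|j u IH]; first by rewrite !word_prod_nil expr0 scale1r.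
by rewrite !word_prod_cons IH -scalemxAl -scalemxAr scalerA exprS.
Qed.

Section DominantToCore.
Context {R : realType} {n m : nat}.
Variables (A : 'I_m -> 'M[R]_n.+1) (w : seq 'I_m) (lam : R[i]).
Hypotheses (A0 : family_nonneg A) (irr : positively_irreducible A).
Hypothesis dom : unique_dominant_product A w.
Hypothesis hlam : unique_simple_leading_eigenvalue (word_prod A w) lam.
Local Notation W := (word_prod A).
Local Notation d := n.+1.
Let q := nu A w.

Lemma dominant_ne : w <> [::].
Proof. by have [h _ _] := dom; have [] := h w erefl. Qed.

Lemma nu_ge0 u : 0 <= nu A u. Proof. exact: powR_ge0. Qed.

Lemma nu_expr u : u <> [::] -> nu A u ^+ size u = spectral_radius (W u).
Proof.
move=> une; have su : (size u)%:R != 0 :> R by rewrite pnatr_eq0 size_eq0; apply/eqP.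
rewrite -powR_mulrn ?nu_ge0 // /nu -powRrM mulVf // powRr1 //.
exact: spectral_radius_ge0.
Qed.

(** Raising the condition on [nu] to the power [size s] removes the roots and leaves one factor
    [1 - eps] for all lengths. *)
Lemma dominant_gap : exists eps : R, [/\ 0 < eps, eps < 1 &
  forall s, s <> [::] -> ~ dominated w s ->
    spectral_radius (W s) <= (1 - eps) * q ^+ size s].
Proof.
have [_ _ [q' [hq [eps [e0 e1 hgap]]]]] := dom.
have Eq : q' = q by rewrite -(hq w erefl).
exists eps; split=> // s sne nd; rewrite -nu_expr //.
have e1' : 0 <= 1 - eps by rewrite subr_ge0 ltW.
have := hgap s sne; rewrite Eq => h.
have {h}h : nu A s <= (1 - eps) `^ (size s)%:R^-1 * q.
  apply: h => -[w' [u [k [-> [i ->] Es]]]]; apply: nd; exists i, k; exact: Es.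
have su : (size s)%:R != 0 :> R by rewrite pnatr_eq0 size_eq0; apply/eqP.
apply: le_trans (_ : ((1 - eps) `^ (size s)%:R^-1 * q) ^+ size s <= _).
  by rewrite lerXn2r ?nnegrE ?nu_ge0 // mulr_ge0 ?powR_ge0 ?nu_ge0.
have Epow : ((1 - eps) `^ (size s)%:R^-1) ^+ size s = 1 - eps.
  by rewrite -powR_mulrn ?powR_ge0 // -powRrM mulVf // powRr1.
by rewrite exprMn Epow.
Qed.

(** For a power of a rotation of [w], cyclicity of the trace reduces the claim to a power of [W w];
    for other nonempty words the spectral gap applies. *)
Lemma trace_word_le u : \tr (W u) <= d%:R * q ^+ size u.
Proof.
have [->|/eqP une] := eqVneq u [::].
  by rewrite word_prod_nil mxtrace1 expr0 mulr1.
have [[i [k Eu]]|nd] := pselect (dominated w u).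
  have [x [y [Ew Er]]] := rot_split w i; rewrite Er in Eu.
  case: k Eu => [|k] Eu; first by rewrite Eu in une.
  have -> : \tr (W u) = \tr (W w ^+ k.+1).
    rewrite Eu word_pow_shift !word_prod_cat mxtrace_mulC -!mulmxA -Ew.
    by rewrite word_prod_pow -word_prod_cat -Ew exprSr.
  have -> : q ^+ size u = spectral_radius (W w) ^+ k.+1.
    rewrite -nu_expr; last exact: dominant_ne.
    by rewrite -exprM Eu size_word_pow size_cat addnC -size_cat -Ew mulnC.
  by apply: trace_exp_le => z; exact: eigenvalue_le_radius.
have [eps [e0 e1 /(_ u une nd) hu]] := dominant_gap.
have := @trace_exp_le _ _ (W u) (q ^+ size u) 1%N; rewrite !expr1; apply => z.
move/eigenvalue_le_radius/le_trans; apply; rewrite lecR; apply: le_trans hu _.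
by rewrite ler_piMl ?exprn_ge0 ?nu_ge0 // lerBlDr lerDl ltW.
Qed.

(** For a fixed [s] with [W s j i > 0], this bounds one entry of every product by a trace, hence by
    a power of [q]. *)
Lemma entry_trace_le s u i j : W s j i * W u i j <= \tr (W (s ++ u)).
Proof.
have Wge0 t : mx_nonneg (W t) by exact: word_prod_nonneg.
rewrite word_prod_cat /mxtrace (bigD1 j) //= mxE (bigD1 i) //= -addrA lerDl.
rewrite addr_ge0 //; first by apply: sumr_ge0 => k _; rewrite mulr_ge0 ?Wge0.
by apply: sumr_ge0 => k _; apply: mx_nonnegM.
Qed.

Lemma return_word i j : exists s, 0 < W s j i.
Proof.
have [||s hs] := @irreducible_reach _ _ _ A (delta_mx i 0) A0 irr _ _ j.
- by apply/coneP => k; rewrite mxE ler0n.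
- by apply/eqP => /colP/(_ i); rewrite !mxE !eqxx => /eqP; rewrite oner_eq0.
by exists s; move: hs; rewrite -colE mxE.
Qed.

Lemma zero_radius : q = 0 -> forall j, A j = 0.
Proof.
move=> q0 k; apply/matrixP => i j; rewrite mxE; apply/eqP; rewrite eq_le A0 andbT.
have [s hs] := return_word i j.
have := le_trans (entry_trace_le s [:: k] i j) (trace_word_le _).
rewrite q0 size_cat addn1 exprS mul0r mulr0 word_prod_cons word_prod_nil mulmx1.
by rewrite pmulr_rle0.
Qed.

Lemma core_exists : 0 < q -> exists v r, core (fun j => q^-1 *: A j) w v r.
Proof.
move=> q0; have wne := dominant_ne; set B := fun j : 'I_m => _.
have qk k : 0 < q ^+ k by rewrite exprn_gt0.
have WB u : word_prod B u = (q ^+ size u)^-1 *: W u.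
  by rewrite word_prod_scale exprVn.
have radw : spectral_radius (W w) = q ^+ size w by rewrite -nu_expr.
have Elam : (q ^+ size w)%:C%C = `|lam|.
  have [elam lmax _ _] := hlam.
  by rewrite -radw; apply: spectral_radius_eq.
have [v [r [v0 r0 rv [wv rw] lim]]] :=
  leading_projection (word_prod_nonneg _ A0) hlam Elam (qk _).
have B0 : family_nonneg B by move=> j k l; rewrite mxE mulr_ge0 // ?A0 // invr_ge0 ltW.
exists v, r; split=> //.
- move=> [S [S0 ST hS]]; apply: irr; exists S; split=> // j _ [x hx <-].
  move=> i iS; have := hS j (B j *m x); rewrite /=.
  move=> /(_ (ex_intro2 _ _ x hx erefl) i iS).
  rewrite /B -scalemxAl mxE => /eqP; rewrite mulf_eq0 invr_eq0 gt_eqF //=.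
  by move/eqP.
(* One return word per position bounds that entry of every normalized product; the sum of these
   finitely many bounds serves all entries. *)
- pose s_ i j := sval (cid (return_word i j)).
  have s_P i j : 0 < W (s_ i j) j i by rewrite /s_; case: cid.
  have pB i j : 0 < word_prod B (s_ i j) j i.
    by rewrite WB mxE mulr_gt0 ?invr_gt0.
  exists (\sum_i \sum_j d%:R / word_prod B (s_ i j) j i) => u.
  have pos i j : 0 <= d%:R / word_prod B (s_ i j) j i by rewrite divr_ge0 // ltW.
  have Wge0 : mx_nonneg (word_prod B u) by exact: word_prod_nonneg.
  apply: mx_norm_le => [|i j]; first by do 2![apply: sumr_ge0 => *].
  apply: (@le_trans _ _ (d%:R / word_prod B (s_ i j) j i)); last first.
    rewrite (bigD1 i) //= (bigD1 j) //= -addrA lerDl addr_ge0 //.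
      exact: sumr_ge0.
    by do 2![apply: sumr_ge0 => *].
  rewrite ger0_norm // ler_pdivlMr // mulrC !WB !mxE.
  rewrite mulrACA -invfM -exprD -size_cat mulrC ler_pdivrMr //.
  exact: le_trans (entry_trace_le _ _ _ _) (trace_word_le _).
- have [eps [e0 e1 hgap]] := dominant_gap.
  exists (eps ^+ d) => [|s sne nd]; first exact: exprn_gt0.
  have [rs hrs /(_ (q ^+ size s)^-1) hsc] := spectrum_ofE (W s).
  rewrite WB; apply: det_gap hsc e0 e1 _ => _ /mapP[z zrs ->].
  have hz : `|z| <= (spectral_radius (W s))%:C%C.
    by apply: eigenvalue_le_radius; rewrite -(spectrum_mem _ hrs).
  have ci : 0 < (q ^+ size s)^-1 by rewrite invr_gt0.
  rewrite normrM norm_real_complex (gtr0_norm ci).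
  apply: le_trans (ler_wpM2l _ hz) _; first by rewrite ler0c invr_ge0 ltW.
  by rewrite -rmorphM lecR ler_pdivrMl // mulrC hgap.
- by rewrite WB.
- by rewrite WB.
- by move=> e /lim[N hN]; exists N => k /hN; rewrite WB.
Qed.

End DominantToCore.

(** * The joint spectral radius *)

Section Jsr.
Context {R : realType} {d m : nat}.

Lemma powR_inv_cvg1 (c : R) : 0 < c -> (fun k : nat => c `^ k%:R^-1) @ \oo --> (1 : R).
Proof.
move=> c0; rewrite -(cvg_shiftS (fun k : nat => c `^ k%:R^-1)) /=.
rewrite (_ : (fun k => _) = fun k => expR (k.+1%:R^-1 * ln c)); last first.
  by apply/funext => k; rewrite /powR gt_eqF.
have h : (fun k : nat => k.+1%:R^-1 * ln c) @ \oo --> 0 * ln c.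
  by apply: cvgM; [exact: cvg_harmonic | exact: cvg_cst].
by have := cvg_comp _ _ h (@continuous_expR R _); rewrite mul0r expR0.
Qed.

(** The largest norm of a product of [k] matrices of [B] lies between two positive constants, whose
    [k]-th roots tend to 1. *)
Lemma jsr_core (B : 'I_m -> 'M[R]_d) w v r (q : R) :
  core B w v r -> 0 < q -> jsr (fun j => q *: B j) = q.
Proof.
move=> cB q0; have [C C0 hC] := core_bound cB; have v0 := core_vneq0 cB.
have nv : 0 < `|v| by rewrite normr_gt0.
have d0 : 0 < d%:R :> R by rewrite ltr0n (core_dpos cB).
pose c := (d%:R * (d%:R * C))^-1; have c0 : 0 < c by rewrite invr_gt0 !mulr_gt0.
(* The prefix of length [k] of [w^k] cannot be small: it maps the bounded vector obtained from [v]
   by the rest of the word back to [v]. *)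
have low k : exists u : k.-tuple 'I_m, c <= `|word_prod B u|.
  have wpos : (0 < size w)%N by have := core_wne cB; case: (w).
  have sk : (k <= size (word_pow w k))%N by rewrite size_word_pow leq_pmulr.
  have su : size (take k (word_pow w k)) == k by rewrite size_takel.
  exists (Tuple su) => /=; set u := take _ _; set u' := drop k (word_pow w k).
  have Ev : v = word_prod B u *m (word_prod B u' *m v).
    by rewrite mulmxA -word_prod_cat cat_take_drop (core_powv cB).
  have : `|v| <= d%:R * (`|word_prod B u| * (d%:R * (C * `|v|))).
    rewrite [X in `|X| <= _]Ev; apply: le_trans (mx_normM _ _) _.
    rewrite ler_wpM2l // ler_wpM2l //; apply: le_trans (mx_normM _ _) _.
    by rewrite ler_wpM2l // ler_wpM2r.
  rewrite (_ : d%:R * _ = `|word_prod B u| * (d%:R * (d%:R * C)) * `|v|); last by ring.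
  rewrite -[leLHS]mul1r ler_pM2r // /c -[(_ * _)^-1]mul1r ler_pdivrMr //.
  by rewrite !mulr_gt0.
rewrite /jsr; apply: cvg_lim => //.
have lim (a : R) : 0 < a -> (fun k : nat => q * a `^ k%:R^-1) @ \oo --> q.
  move=> a0; have : (fun k : nat => q * a `^ k%:R^-1) @ \oo --> q * 1.
    by apply: cvgM; [exact: cvg_cst | exact: powR_inv_cvg1].
  by rewrite mulr1.
apply: (squeeze_cvgr _ (lim c c0) (lim C C0)).
exists 1%N => // k /= k1.
have kn0 : k%:R != 0 :> R by rewrite pnatr_eq0 -lt0n.
have nrm (u : k.-tuple 'I_m) : `|word_prod (fun j => q *: B j) u| `^ k%:R^-1 =
    q * `|word_prod B u| `^ k%:R^-1.
  rewrite word_prod_scale size_tuple normrZ ger0_norm ?exprn_ge0 ?(ltW q0) //.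
  rewrite powRM // ?exprn_ge0 ?(ltW q0) // -powR_mulrn ?(ltW q0) //.
  by rewrite -powRrM mulfV // powRr1 // ltW.
apply/andP; split.
  have [u hu] := low k; apply: le_trans (le_bigmax _ _ u); rewrite nrm.
  rewrite ler_pM2l //; apply: ge0_ler_powR => //;
  by rewrite ?nnegrE ?(ltW c0) ?invr_ge0.
apply: bigmax_le => [|u _]; first by rewrite mulr_ge0 ?powR_ge0 // ltW.
rewrite nrm ler_pM2l //; apply: ge0_ler_powR => //;
by rewrite ?nnegrE ?invr_ge0 //; exact: ltW.
Qed.

End Jsr.

(** * Assembling the conclusions and transferring them to the original family *)

Section CoreConclusion.
Context {R : realType} {d : nat}.

Lemma fixed_body_exists_unique m (B : 'I_m -> 'M[R]_d) w v r : core B w v r ->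
  exists G : set 'cV[R]_d, [/\ fixed_body B G, mono_polytope G &
    forall G', fixed_body B G' -> exists2 c : R, 0 < c & G' = scale_set c G].
Proof.
move=> cB; have [n [fQ orb]] := orbit_hull_fixed cB.
exists (orbit_hull B v n); split=> //.
  exists [set` orbit_seq B v n]; split=> //; first exact: finite_seq.
  exact: (orbit_seq_cone cB).
by move=> G' fG'; exact: (fixed_body_unique cB).
Qed.

Lemma fixed_body_seq m (B : 'I_m -> 'M[R]_d) w v r G : core B w v r ->
  fixed_body B G ->
  exists2 s : seq 'cV[R]_d, [set` s] `<=` cone & G = mono_hull [set` s].
Proof.
move=> cB fG; have [n [fQ orb]] := orbit_hull_fixed cB.
have sc : [set` orbit_seq B v n] `<=` cone by move=> x; exact: (orbit_seq_cone cB).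
have [c c0 ->] := fixed_body_unique cB fG fQ orb.
have E : scale_set c [set` orbit_seq B v n] =
    [set` [seq c *: x | x <- orbit_seq B v n]].
  apply/seteqP; split=> [_ [x xs <-]|_ /= /mapP[x xs ->]]; last by exists x.
  by apply/mapP; exists x.
exists [seq c *: x | x <- orbit_seq B v n]; last by rewrite -E scale_mono_hull.
by rewrite -E => _ [x xs <-]; apply: coneZ; [exact: ltW | exact: sc].
Qed.

(** By uniqueness, any invariant body of the dual is a multiple of an orbit polytope, so it has a
    vertex set; the norm is the support function taken over these vertices. *)
Lemma fixed_vertex_norm m (B : 'I_m -> 'M[R]_d) w v r Gs : core B w v r ->
  fixed_body (dual_family B) Gs ->
  exists (V : set 'cV[R]_d) (f : 'cV[R]_d -> R),
    [/\ is_vertex_set Gs V,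
        forall x, cone x -> is_max [set dotp v x | v in V] (f x)
      & fixed_norm B f].
Proof.
move=> cB fG; have [s sc Es] := fixed_body_seq (core_dual cB) fG.
have [z Gz z0] := mono_body_pos fG.1.
have zn0 : z != 0.
  apply/eqP => z_0; have := z0 (Ordinal (core_dpos cB)).
  by rewrite z_0 mxE ltxx.
have [|s' vs'] := vertex_set_exists sc Es; first by exists z.
have [_ s'c Es' _] := vs'; rewrite Es' in fG.
have j0 : 'I_m by have := core_wne cB; case: (w) => [//|j l _]; exact: j.
have [h1 h2] := support_fun_fixed j0 (core_nonneg cB) s'c fG.
by exists [set` s'], (support_fun s').
Qed.

(** [A] enters only through its invariant bodies, those of its dual, and its norms, so [B] may be
    indexed differently; the zero family exploits this. *)
Lemma conclude_from_core m m' (A : 'I_m -> 'M[R]_d) (B : 'I_m' -> 'M[R]_d) w v r :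
  core B w v r ->
  (forall G, invariant_body A G <-> fixed_body B G) ->
  (forall G, invariant_body (dual_family A) G <-> fixed_body (dual_family B) G) ->
  (forall f, barabanov A f <-> fixed_norm B f) ->
  [/\ exists G : set 'cV[R]_d,
        [/\ invariant_body A G,
            mono_polytope G
          & forall G', invariant_body A G' ->
              exists2 c : R, 0 < c & G' = scale_set c G],
      exists f : 'cV[R]_d -> R,
        barabanov A f /\
        forall f', barabanov A f' ->
          exists2 c : R, 0 < c & forall x, cone x -> f' x = c * f x,
      exists Gs : set 'cV[R]_d,
        [/\ invariant_body (dual_family A) Gs,
            mono_polytope Gs
          & forall G', invariant_body (dual_family A) G' ->
              exists2 c : R, 0 < c & G' = scale_set c Gs]
    & forall Gs : set 'cV[R]_d, invariant_body (dual_family A) Gs ->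
        exists (V : set 'cV[R]_d) (f : 'cV[R]_d -> R),
          [/\ is_vertex_set Gs V,
              forall x, cone x -> is_max [set dotp v x | v in V] (f x)
            & barabanov A f]].
Proof.
move=> cB hA hD hN; split.
- have [G [fG pG uG]] := fixed_body_exists_unique cB.
  by exists G; split=> // [|G' /hA]; [exact/hA | exact: uG].
- have [Gs [fG _ _]] := fixed_body_exists_unique (core_dual cB).
  have [V [f [_ _ nf]]] := fixed_vertex_norm cB fG.
  exists f; split=> [|f' /hN nf']; first exact/hN.
  exact: (fixed_norm_unique cB).
- have [G [fG pG uG]] := fixed_body_exists_unique (core_dual cB).
  by exists G; split=> // [|G' /hD]; [exact/hD | exact: uG].
- move=> Gs /hD fG; have [V [f [h1 h2 h3]]] := fixed_vertex_norm cB fG.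
  by exists V, f; split=> //; exact/hN.
Qed.

Lemma invariant_body_scaled m (A B : 'I_m -> 'M[R]_d) (q : R) G :
  family_nonneg B -> A = (fun j => q *: B j) -> 0 < q -> jsr A = q ->
  invariant_body A G <-> fixed_body B G.
Proof.
move=> B0 EA q0 Ej; rewrite /invariant_body /fixed_body Ej.
suff E : mono_body G -> mono_hull (\bigcup_j [set A j *m x | x in G]) =
    scale_set q (mono_hull (\bigcup_j [set B j *m x | x in G])).
  split=> -[bG]; rewrite E // => EG; split=> //; last by rewrite -EG.
  have q1 : q != 0 by rewrite gt_eqF.
  by rewrite -[LHS](scale_setK _ q1) EG scale_setK.
move=> [_ _ _ Gc _]; rewrite scale_mono_hull //; last first.
  by move=> _ [j _ [x Gx <-]]; apply: coneM => //; exact: Gc.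
congr mono_hull; apply/seteqP; split.
  move=> _ [j _ [x Gx <-]]; exists (B j *m x); last by rewrite EA scalemxAl.
  by exists j => //; exists x.
move=> _ [_ [j _ [x Gx <-]] <-]; exists j => //; exists x => //.
by rewrite EA scalemxAl.
Qed.

Lemma barabanov_scaled m (A B : 'I_m -> 'M[R]_d) (q : R) f :
  family_nonneg B -> A = (fun j => q *: B j) -> 0 < q -> jsr A = q ->
  barabanov A f <-> fixed_norm B f.
Proof.
move=> B0 EA q0 Ej; rewrite /barabanov /fixed_norm Ej.
have hom j x : mono_norm f -> cone x -> f (A j *m x) = q * f (B j *m x).
  move=> [[hom _ _] _] cx; rewrite EA -scalemxAl hom //; first exact: ltW.
  exact: coneM.
split=> -[nf hf]; split=> // x cx; have [[j _ Ej'] ub] := hf x cx; split.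
- exists j => //; move: Ej'; rewrite hom //; apply: mulfI; exact: lt0r_neq0.
- by move=> _ [i _ <-]; rewrite -(ler_pM2l q0) -hom //; apply: ub; exists i.
- by exists j => //; rewrite hom // Ej'.
- by move=> _ [i _ <-]; rewrite hom // ler_pM2l //; apply: ub; exists i.
Qed.

End CoreConclusion.

(* If [nu A w = 0] then [A = 0] and [d = 1].  Every monotone body is then
   invariant, exactly as for the single matrix 1, which satisfies [core]. *)
Section ZeroFamily.
Context {R : realType} {m : nat}.

Lemma ord1_set_trivial (S : {set 'I_1}) : 
  S != finset.set0 -> ~ S \proper finset.setTfor 'I_1.
Proof.
move=> /finset.set0Pn[i iS]; rewrite finset.properT => /eqP; apply.
by apply/finset.setP => k; rewrite finset.in_setT (ord1 k) -(ord1 i).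
Qed.

Definition unit_family : 'I_1 -> 'M[R]_1 := fun=> 1%:M.

Lemma word_prod_unit u : word_prod unit_family u = 1%:M.
Proof. by elim: u => [|j u IH]; rewrite ?word_prod_nil // word_prod_cons IH mulmx1. Qed.

Lemma unit_word (u : seq 'I_1) : u = word_pow [:: ord0] (size u).
Proof. by elim: u => [//|j u {1}->]; rewrite (ord1 j). Qed.

(** Over a one-letter alphabet every word is a power of the letter, so the gap condition is void and
    any positive constant serves. *)
Lemma core_unit : core unit_family [:: ord0] 1%:M 1%:M.
Proof.
have pos : mx_nonneg (1%:M : 'M[R]_1) by move=> i j; rewrite mxE ler0n.
split=> //.
- by move=> [S [S0 ST _]]; exact: (ord1_set_trivial S0 ST).
- by exists `|1%:M : 'M[R]_1| => u; rewrite word_prod_unit.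
- exists 1 => // s sne []; exists 0%N, (size s); rewrite rot0; exact: unit_word.
- by rewrite mulmx1.
- by rewrite word_prod_unit mulmx1.
- by rewrite word_prod_unit mulmx1.
- move=> e e0; exists 0%N => k _.
  rewrite word_prod_unit mulmx1 (_ : 1%:M ^+ k = 1%:M) ?subrr ?normr0 ?ltW //.
  exact: expr1n.
Qed.

Lemma jsr_zero d : jsr (fun _ : 'I_m => 0 : 'M[R]_d) = 0.
Proof.
(* The shift drops the term at 0, which comes from the empty product. *)
rewrite /jsr; apply: cvg_lim => //; rewrite -cvg_shiftS /=.
rewrite (_ : (fun k => _) = fun=> 0); first exact: cvg_cst.
apply/funext => k; apply: bigmax_eq_id => -[[|j u] // us] _ /=.
by rewrite word_prod_cons mul0mx normr0 powR0 // invr_eq0 pnatr_eq0.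
Qed.

Lemma invariant_body_zero d (j0 : 'I_m) G :
  invariant_body (fun _ : 'I_m => 0 : 'M[R]_d) G <-> mono_body G.
Proof.
split=> [[]//|bG]; split=> //; rewrite jsr_zero.
have [z Gz _] := mono_body_pos bG.
have -> : scale_set 0 G = [set 0].
  apply/seteqP; split=> [_ [x _ <-]|_ ->]; first by rewrite scale0r.
  by exists z => //; rewrite scale0r.
have -> : \bigcup_j [set (fun _ : 'I_m => 0 : 'M[R]_d) j *m x | x in G] = [set 0].
  apply/seteqP; split=> [_ [j _ [x _ <-]]|_ ->]; first by rewrite mul0mx.
  by exists j0 => //; exists z; rewrite ?mul0mx.
rewrite mono_hull_id //; rewrite -(@mono_hull_zero R d).
exact: mono_hull_mono_convex.
Qed.

Lemma fixed_body_unit G : fixed_body unit_family G <-> mono_body G.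
Proof.
split=> [[]//|bG]; split=> //.
have -> : \bigcup_j [set unit_family j *m x | x in G] = G.
  apply/seteqP; split=> [_ [j _ [x Gx <-]]|x Gx]; first by rewrite mul1mx.
  by exists ord0 => //; exists x; rewrite ?mul1mx.
by rewrite mono_hull_id //; exact: mono_body_convex.
Qed.

Lemma barabanov_zero d (j0 : 'I_m) f :
  barabanov (fun _ : 'I_m => 0 : 'M[R]_d) f <-> mono_norm f.
Proof.
split=> [[]//|nf]; split=> // x cx; rewrite jsr_zero mul0r.
have f0 : f 0 = 0.
  by case: nf => -[hom _ _] _; rewrite -(scale0r x) hom ?mul0r.
by split=> [|_ [j _ <-]]; [exists j0; rewrite ?mul0mx | rewrite mul0mx f0].
Qed.

Lemma fixed_norm_unit f : fixed_norm unit_family f <-> mono_norm f.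
Proof.
split=> [[]//|nf]; split=> // x cx.
by split=> [|_ [j _ <-]]; [exists ord0; rewrite ?mul1mx | rewrite mul1mx].
Qed.
End ZeroFamily.

(** Zero matrices leave every coordinate subspace invariant, so irreducibility permits only one
    coordinate. *)
Lemma zero_irreducible_dim (R : realType) n m (A : 'I_m -> 'M[R]_n.+1) :
  positively_irreducible A -> (forall j, A j = 0) -> n = 0%N.
Proof.
move=> irr A0; case: n A irr A0 => // n A irr A0; case: irr.
exists (finset.set1 ord0); split.
- by apply/finset.set0Pn; exists ord0; rewrite finset.in_set1.
- rewrite finset.properT; apply/eqP => /finset.setP/(_ ord_max).
  by rewrite finset.in_set1 finset.in_setT.
- by move=> j _ [x _ <-] i _; rewrite A0 mul0mx mxE.
Qed.

Theorem theorem9 (R : realType) (d m : nat) (A : 'I_m -> 'M[R]_d)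
    (A_nonneg : family_nonneg A)
    (A_irr : positively_irreducible A)
    (A_dom : exists w : seq 'I_m, unique_dominant_product A w /\
       exists lam : R[i], unique_simple_leading_eigenvalue (word_prod A w) lam) :
  [/\ exists G : set 'cV[R]_d,
        [/\ invariant_body A G,
            mono_polytope G
          & forall G', invariant_body A G' ->
              exists2 c : R, 0 < c & G' = scale_set c G],
      exists f : 'cV[R]_d -> R,
        barabanov A f /\
        forall f', barabanov A f' ->
          exists2 c : R, 0 < c & forall x, cone x -> f' x = c * f x,
      exists Gs : set 'cV[R]_d,
        [/\ invariant_body (dual_family A) Gs,
            mono_polytope Gs
          & forall G', invariant_body (dual_family A) G' ->
              exists2 c : R, 0 < c & G' = scale_set c Gs]
    & forall Gs : set 'cV[R]_d, invariant_body (dual_family A) Gs ->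
        exists (V : set 'cV[R]_d) (f : 'cV[R]_d -> R),
          [/\ is_vertex_set Gs V,
              forall x, cone x -> is_max [set dotp v x | v in V] (f x)
            & barabanov A f]].
Proof.
have [w [dom [lam hlam]]] := A_dom.
case: d A A_nonneg A_irr {A_dom} dom hlam => [|n] A A0 irr dom hlam.
  (* In dimension 0 there is no eigenvector, so the assumed leading eigenvalue cannot exist. *)
  by case: hlam => /eigenvalueP[x _]; rewrite thinmx0 eqxx.
have [q0|qn0] := eqVneq (nu A w) 0.
  have Az := zero_radius A0 irr dom q0.
  have n0 := zero_irreducible_dim irr Az; subst n.
  have EA : A = fun=> 0 by apply/funext.
  have j0 : 'I_m by have := dominant_ne dom; case: (w) => [//|j l _]; exact: j.
  have ED : dual_family A = fun=> 0 by apply/funext => j; rewrite /dual_family Az trmx0.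
  (* The substitute family is its own dual, so it represents both [A] and its dual, which are zero
     here. *)
  have EU : dual_family unit_family = @unit_family R.
    by apply/funext => j; rewrite /dual_family trmx1.
  apply: (conclude_from_core (@core_unit R)).
  - by move=> G; rewrite EA invariant_body_zero // fixed_body_unit.
  - by move=> G; rewrite ED EU invariant_body_zero // fixed_body_unit.
  - by move=> f; rewrite EA barabanov_zero // fixed_norm_unit.
have q0 : 0 < nu A w by rewrite lt_neqAle eq_sym qn0 nu_ge0.
have [v [r cB]] := core_exists A0 irr dom hlam q0.
set B := fun j : 'I_m => _ in cB; set q := nu A w in q0 qn0 B cB.
have EA : A = fun j => q *: B j.
  by apply/funext => j; rewrite /B scalerA divff // scale1r.
have ED : dual_family A = fun j => q *: dual_family B j.
  by apply/funext => j; rewrite /dual_family -linearZ /= /B scalerA divff // scale1r.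
have Ej : jsr A = q by rewrite EA; exact: jsr_core cB q0.
have Ejd : jsr (dual_family A) = q by rewrite ED; exact: jsr_core (core_dual cB) q0.
apply: (conclude_from_core cB).
- by move=> G; apply: invariant_body_scaled EA q0 Ej; exact: core_nonneg cB.
- move=> G; apply: invariant_body_scaled ED q0 Ejd.
  exact: core_nonneg (core_dual cB).
- by move=> f; apply: barabanov_scaled EA q0 Ej; exact: core_nonneg cB.
Qed.
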